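(* Let $p\ge 1$ be an integer. The Compact Approximate Taylor (CAT) method of parameter $p$ for the scalar conservation law $u_t+f(u)_x=0$ is of order $2p$. That is, if $f$ is smooth enough, $u$ is a smooth enough exact solution of $u_t+f(u)_x=0$, and the numerical fluxes $F^p_{i\pm1/2}$ of the CAT method are computed from the exact point values $u^n_i=u(x_i,t_n)$, then, as $\Delta x\to0$ with $\Delta t/\Delta x$ constant, $$u(x_i,t_{n+1})-u(x_i,t_n)+\frac{\Delta t}{\Delta x}\left(F^p_{i+1/2}-F^p_{i-1/2}\right)=O(\Delta x^{2p+1}).$$
   Context: Notation: $x_i$ are the nodes of a uniform mesh of step $\Delta x$, $\Delta t>0$ is the time step, $t_{n+1}=t_n+\Delta t$. Coefficients. For $-p\le j\le p$, $\delta^1_{p,j}=F_{p,j}'(0)$, where $F_{p,j}(x)=\prod_{r=-p,\,r\ne j}^{p}\frac{x-r}{j-r}$. For integers $q\in\{-p+1,\dots,p\}$, $0\le k\le 2p-1$ and $-p+1\le j\le p$, $\gamma^{k,q}_{p,j}=L_{p,j}^{(k)}(q)$, where $L_{p,j}(x)=\prod_{r=-p+1,\,r\neq j}^{p}\frac{x-r}{j-r}$; thus $\sum_{j=-p+1}^p \gamma^{k,q}_{p,j}g(j)$ is the interpolatory formula for $g^{(k)}(q)$ based on the $2p$ nodes $-p+1,\dots,p$. The coefficients $\gamma^{0,1/2}_{p,j}$, $-p+1\le j\le p$, are obtained from the $\delta^1_{p,j}$ through the relations $\delta^1_{p,p}=\gamma^{0,1/2}_{p,p}$, $\delta^1_{p,j}=\gamma^{0,1/2}_{p,j}-\gamma^{0,1/2}_{p,j+1}$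 for $-p+1\le j\le p-1$, and $\delta^1_{p,-p}=-\gamma^{0,1/2}_{p,-p+1}$; equivalently $\gamma^{0,1/2}_{p,j}=\sum_{r=j}^p\delta^1_{p,r}$. (For $p=2$ they are $-1/12,\,7/12,\,7/12,\,-1/12$.) CAT method for $u_t+f(u)_x=0$: $$u_i^{n+1}=u_i^n+\frac{\Delta t}{\Delta x}\left(F^p_{i-1/2}-F^p_{i+1/2}\right),\qquad F^p_{i+1/2}=\sum_{k=1}^{2p}\frac{\Delta t^{k-1}}{k!}\sum_{j=-p+1}^p\gamma^{0,1/2}_{p,j}\,\tilde f^{(k-1)}_{i,j}.$$ For each $i$, the numbers $\tilde f^{(k)}_{i,j}$ ($-p+1\le j\le p$) are computed recursively as follows. Set $\tilde f^{(0)}_{i,j}=f(u^n_{i+j})$. For $k=1,\dots,2p-1$ set, for $j,r\in\{-p+1,\dots,p\}$, $$\tilde u^{(k)}_{i,j}=-\frac1{\Delta x}\sum_{s=-p+1}^p\gamma^{1,j}_{p,s}\,\tilde f^{(k-1)}_{i,s},$$ $$\tilde f^{k,n+r}_{i,j}=f\left(u^n_{i+j}+\sum_{l=1}^k\frac{(r\Delta t)^l}{l!}\tilde u^{(l)}_{i,j}\right),$$ $$\tilde f^{(k)}_{i,j}=\frac1{\Delta t^k}\sum_{r=-p+1}^p\gamma^{k,0}_{p,r}\,\tilde f^{k,n+r}_{i,j}.$$ The $O$ estimate is understood at a fixed point $(x_i,t_n)=(x,t)$ around which $u$ is smooth. *)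

(* Defs.v *)
From HB Require Import structures.
From mathcomp Require Import all_boot all_order all_algebra.
From mathcomp Require Import all_classical all_reals all_analysis.

Set Implicit Arguments.
Unset Strict Implicit.
Unset Printing Implicit Defensive.

Import Order.TTheory GRing.Theory Num.Theory.
Import numFieldNormedType.Exports.

Local Open Scope ring_scope.
Local Open Scope classical_set_scope.

(* On an open subset [A] of a finite-dimensional space this is the usual class
   C^k: quantifying over all directions [v], rather than over the vectors of a
   basis, makes no difference when the derivatives are continuous. *)
Fixpoint class_C (R : realType) (V : normedModType R) (k : nat)
    (A : set V) (g : V -> R) : Prop :=
  (forall a, A a -> {for a, continuous g}) /\
  (if k is k'.+1 then
     forall v : V, (forall a, A a -> derivable (g : V -> R^o) a v) /\
                   class_C k' A ('D_v (g : V -> R^o))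
   else True).

(* The integers a, a + 1, ..., b; meant for a <= b + 1, because of the absolute
   value. *)
Definition zrange (a b : int) : seq int :=
  [seq a + m%:Z | m <- iota 0 `|(b + 1 - a)%R|%N].

Definition lagrange_basis (R : realType) (s : seq int) (j : int) : {poly R} :=
  \prod_(r <- s | r != j) ((j - r)%:~R^-1 *: ('X - (r%:~R)%:P)).

Definition delta1 (R : realType) (p : nat) (j : int) : R :=
  (lagrange_basis R (zrange (- p%:Z) p%:Z) j)^`().[0].

Definition stencil (p : nat) : seq int := zrange (- p%:Z + 1) p%:Z.

Definition gamma (R : realType) (p k : nat) (q j : int) : R :=
  (lagrange_basis R (stencil p) j)^`(k).[q%:~R].

(* gamma^{0,1/2}_{p,j}, for -p+1 <= j <= p: the solution of
   delta1_p = gamma_p, delta1_j = gamma_j - gamma_{j+1} (-p+1 <= j <= p-1) and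
   delta1_{-p} = - gamma_{-p+1}; the last relation is then automatic, since the
   delta1_j sum to 0. *)
Definition gamma_half (R : realType) (p : nat) (j : int) : R :=
  \sum_(r <- zrange j p%:Z) delta1 R p r.

(* Below, [w j] stands for u^n_{i+j}, the index i being fixed. *)

(* One evaluation of utilde^{(k)}_{i,j} from [g s] = ftilde^{(k-1)}_{i,s}. *)
Definition cat_du (R : realType) (p : nat) (dx : R) (g : int -> R) (j : int)
    : R :=
  - dx^-1 * \sum_(s <- stencil p) gamma R p 1 j s * g s.

(* ftilde^{k,n+r}_{i,j}, where k = size us and
   us = [:: utilde^{(1)}_i; ...; utilde^{(k)}_i]. *)
Definition cat_predict (R : realType) (f : R -> R) (dt : R) (w : int -> R)
    (us : seq (int -> R)) (r j : int) : R :=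
  f (w j + \sum_(1 <= l < (size us).+1)
             (r%:~R * dt) ^+ l / l`!%:R * nth (fun=> 0) us l.-1 j).

(* ftilde^{(k)}_{i,j}, with k and us as in [cat_predict]. *)
Definition cat_df (R : realType) (p : nat) (f : R -> R) (dt : R)
    (w : int -> R) (us : seq (int -> R)) (j : int) : R :=
  if us is [::] then f (w j) else
  (dt ^+ size us)^-1 *
    \sum_(r <- stencil p) gamma R p (size us) 0 r * cat_predict f dt w us r j.

(* [:: utilde^{(1)}_i; ...; utilde^{(k)}_i] *)
Fixpoint cat_us (R : realType) (p : nat) (f : R -> R) (dt dx : R)
    (w : int -> R) (k : nat) : seq (int -> R) :=
  if k is k'.+1 then
    let us := cat_us p f dt dx w k' in
    rcons us (cat_du p dx (cat_df p f dt w us))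
  else [::].

(* utilde^{(k)}_{i,j}, for 1 <= k; [U] is the grid function u^n. *)
Definition cat_ut (R : realType) (p : nat) (f : R -> R) (dt dx : R)
    (U : int -> R) (i : int) (k : nat) (j : int) : R :=
  nth (fun=> 0) (cat_us p f dt dx (fun m => U (i + m)) k) k.-1 j.

(* ftilde^{(k)}_{i,j} *)
Definition cat_ft (R : realType) (p : nat) (f : R -> R) (dt dx : R)
    (U : int -> R) (i : int) (k : nat) (j : int) : R :=
  let w m := U (i + m) in cat_df p f dt w (cat_us p f dt dx w k) j.

(* F^p_{i+1/2} *)
Definition cat_flux (R : realType) (p : nat) (f : R -> R) (dt dx : R)
    (U : int -> R) (i : int) : R :=
  \sum_(1 <= k < (2 * p).+1) dt ^+ k.-1 / k`!%:R *
    \sum_(j <- stencil p) gamma_half R p j * cat_ft p f dt dx U i k.-1 j.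

Definition node (R : realType) (x0 dx : R) (k : int) : R := x0 + k%:~R * dx.

(* The lists [us] are only bookkeeping: [cat_ft0], [cat_utS] and [cat_ftS] give
   back the recursion defining ftilde and utilde. *)

Lemma size_cat_us (R : realType) p (f : R -> R) dt dx w k :
  size (cat_us p f dt dx w k) = k.
Proof. by elim: k => //= k IH; rewrite size_rcons IH. Qed.

Lemma nth_cat_us (R : realType) p (f : R -> R) dt dx w k l : (l < k)%N ->
  nth (fun=> 0) (cat_us p f dt dx w k) l =
  nth (fun=> 0) (cat_us p f dt dx w l.+1) l.
Proof.
elim: k => // k IH; rewrite ltnS leq_eqVlt => /predU1P[-> //|lk].
by rewrite [in LHS]/= nth_rcons size_cat_us lk IH.
Qed.

Lemma cat_ft0 (R : realType) p (f : R -> R) dt dx U i j :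
  cat_ft p f dt dx U i 0 j = f (U (i + j)).
Proof. by []. Qed.

Lemma cat_utS (R : realType) p (f : R -> R) dt dx U i k j :
  cat_ut p f dt dx U i k.+1 j =
  - dx^-1 * \sum_(s <- stencil p) gamma R p 1 j s * cat_ft p f dt dx U i k s.
Proof. by rewrite /cat_ut /= nth_rcons size_cat_us ltnn eqxx. Qed.

Lemma cat_ftS (R : realType) p (f : R -> R) dt dx U i k j : (0 < k)%N ->
  cat_ft p f dt dx U i k j =
  (dt ^+ k)^-1 * \sum_(r <- stencil p) gamma R p k 0 r *
    f (U (i + j) + \sum_(1 <= l < k.+1)
         (r%:~R * dt) ^+ l / l`!%:R * cat_ut p f dt dx U i l j).
Proof.
move=> k0; rewrite /cat_ft /cat_df.
case E : (cat_us _ _ _ _ _ _) => [|a s].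
  by move: (size_cat_us p f dt dx (fun m => U (i + m)) k) k0; rewrite E => <-.
rewrite -E size_cat_us; congr (_ * _); apply: eq_bigr => r _; congr (_ * _).
rewrite /cat_predict size_cat_us; congr (f (_ + _)).
apply: eq_big_nat => l /andP[l0 lk]; rewrite /cat_ut nth_cat_us ?prednK //.
Qed.

(* Main.v *)
(* Write h = dx, dt = lambda h and n = 2p. Multiplying u~^(k) and f~^(k) by dt^k removes
   every division from the scheme, so that everything can be expanded in powers of h
   modulo O(h^(n+1)). Let Q(X,T) be the Taylor polynomial of u at (x,t) and G = P o Q,
   P being that of f; the equation says that the coefficients of Q_T + G_X of total
   degree < n vanish. By induction on k, with sigma = 0 for F_{i+1/2} and sigma = -1 for
   F_{i-1/2},
     dt^k f~^(k)_{i+sigma,j} = k! dt^k [T^k]G((sigma + j) h) + C_{k,j} h^n + O(h^(n+1)),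
   and similarly for u~^(k) and Q. The point is that C_{k,j} does not depend on sigma:
   the 2p-point formulas are exact up to degree n - 1, and their defect on X^n is
   invariant under translation. Hence the C_{k,j} cancel in the difference of the two
   fluxes, where summation by parts turns the gamma^{0,1/2} into the (2p+1)-point formula
   delta^1, which is exact up to degree n. *)

Require Import Defs.
From HB Require Import structures.
From mathcomp Require Import all_boot all_order all_algebra.
From mathcomp Require Import all_classical all_reals all_analysis.
From mathcomp Require Import zify ring lra.
Set Implicit Arguments.
Unset Strict Implicit.
Unset Printing Implicit Defensive.
Import Order.TTheory GRing.Theory Num.Theory.
Import numFieldNormedType.Exports.
Local Open Scope ring_scope.
Local Open Scope classical_set_scope.

(** * Orders of smallness *)

(** The error [C_{k,j} h^n] is the obstacle: [dt / dx] is constant, so each flux by itself is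
    accurate only to [O(h^n)], and the missing order has to come from the difference of the two.
    Grouping by nodes does not provide it: [cat_ft] at [(i, j)] and at [(i - 1, j + 1)] belong to
    the same node but are computed from different stencils, with errors [C_{k,j}] and [C_{k,j+1}].
    The fluxes are therefore compared at equal local index [j], and only the exact parts, which
    depend on the node alone, are summed by parts. Every value of [u] that is compared lies on a ray
    [(x + a h, t + b h)] with [(a, b)] fixed, so one-variable estimates in [h] along finitely many
    rays suffice. The filter is a parameter of [isO] because Taylor remainders are estimated on a
    full neighbourhood of 0, whereas the step tends to 0 from the right. *)

Definition isO (R : realType) (F : set_system R) (n : nat) (g : R -> R) : Prop :=
  exists M : R, \forall h \near F, `|g h| <= M * `|h| ^+ n.

Lemma isO_near (R : realType) (F : set_system R) (FF : Filter F) n (f g : R -> R) :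
  (\forall h \near F, f h = g h) -> isO F n g -> isO F n f.
Proof.
move=> fg [M gM]; exists M; near=> h.
by rewrite (near fg h)//; near: h.
Unshelve. all: by end_near. Qed.

Lemma isO_ext (R : realType) (F : set_system R) n (f g : R -> R) :
  f =1 g -> isO F n g -> isO F n f.
Proof. by move=> /funext ->. Qed.

Lemma isOD (R : realType) (F : set_system R) (FF : Filter F) n (f g : R -> R) :
  isO F n f -> isO F n g -> isO F n (fun h => f h + g h).
Proof.
move=> [M fM] [N gN]; exists (M + N); near=> h.
by rewrite mulrDl (le_trans (ler_normD _ _))// lerD//; near: h.
Unshelve. all: by end_near. Qed.

Lemma isOM (R : realType) (F : set_system R) (FF : Filter F) m n (f g : R -> R) :
  isO F m f -> isO F n g -> isO F (m + n) (fun h => f h * g h).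
Proof.
move=> [M fM] [N gN]; exists (M * N); near=> h.
by rewrite normrM exprD mulrACA ler_pM//; near: h.
Unshelve. all: by end_near. Qed.

Lemma isOC (R : realType) (F : set_system R) (FF : Filter F) (c : R) :
  isO F 0 (fun=> c).
Proof. by exists `|c|; near=> h; rewrite mulr1.
Unshelve. all: by end_near. Qed.

Lemma isOZ (R : realType) (F : set_system R) (FF : Filter F) n (c : R) (f : R -> R) :
  isO F n f -> isO F n (fun h => c * f h).
Proof. by move=> fO; apply: (isOM FF (m := 0)) => //; exact: isOC. Qed.

Lemma isON (R : realType) (F : set_system R) (FF : Filter F) n (f : R -> R) :
  isO F n f -> isO F n (fun h => - f h).
Proof.
move=> fO; apply: (@isO_ext _ _ _ _ (fun h => -1 * f h)); last exact: isOZ.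
by move=> h; rewrite mulN1r.
Qed.

Lemma isOB (R : realType) (F : set_system R) (FF : Filter F) n (f g : R -> R) :
  isO F n f -> isO F n g -> isO F n (fun h => f h - g h).
Proof. by move=> fO gO; apply: isOD => //; exact: isON. Qed.

Lemma isO0 (R : realType) (F : set_system R) (FF : Filter F) n :
  isO F n (fun=> 0 : R).
Proof. by exists 0; near=> h; rewrite normr0 mul0r.
Unshelve. all: by end_near. Qed.

Lemma isOX (R : realType) (F : set_system R) (FF : Filter F) n :
  isO F n (fun h => h ^+ n).
Proof. by exists 1; near=> h; rewrite mul1r normrX.
Unshelve. all: by end_near. Qed.

Lemma isO_sum (R : realType) (F : set_system R) (FF : Filter F) (I : eqType) n
    (s : seq I) (f : I -> R -> R) :
  (forall i, i \in s -> isO F n (f i)) -> isO F n (fun h => \sum_(i <- s) f i h).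
Proof.
elim: s => [|i s IH] fO.
  by apply: (@isO_ext _ _ _ _ (fun=> 0)); [move=> h; rewrite big_nil|exact: isO0].
apply: (@isO_ext _ _ _ _ (fun h => f i h + \sum_(j <- s) f j h)).
  by move=> h; rewrite big_cons.
apply: isOD; first by apply: fO; rewrite mem_head.
by apply: IH => j js; apply: fO; rewrite in_cons js orbT.
Qed.

Lemma isO_le (R : realType) (F : set_system R) (FF : Filter F) m n (f : R -> R) :
  F --> (0 : R) -> (m <= n)%N -> isO F n f -> isO F m f.
Proof.
move=> F0 mn [M fM]; exists `|M|; near=> h.
have h1 : `|h| <= 1.
  near: h; apply: F0; exists 1 => //= h; rewrite /= sub0r normrN; exact: ltW.
rewrite (@le_trans _ _ (M * `|h| ^+ n))//; first by near: h.
rewrite (@le_trans _ _ (`|M| * `|h| ^+ n))//.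
  by rewrite ler_wpM2r// ler_norm.
by rewrite ler_wpM2l// ler_wiXn2l.
Unshelve. all: by end_near. Qed.

Lemma isO_continuous (R : realType) (F : set_system R) (FF : Filter F) (g : R -> R) :
  F --> (0 : R) -> {for 0, continuous g} -> isO F 0 g.
Proof.
move=> F0 /cvgr_dist_le /(_ 1 ltr01) g0; exists (`|g 0| + 1); near=> h.
have : `|g 0 - g h| <= 1 by near: h; exact: F0.
rewrite expr0 mulr1 distrC => /(le_trans (lerB_dist _ _)).
by rewrite lerBlDl.
Unshelve. all: by end_near. Qed.

Lemma isO_poly (R : realType) (F : set_system R) (FF : Filter F) n (P : {poly R}) :
  F --> (0 : R) -> (forall m, (m < n)%N -> P`_m = 0) ->
  isO F n (fun h => P.[h]).
Proof.
move=> F0 P0; apply: (@isO_ext _ _ _ _ (fun h => (drop_poly n P).[h] * h ^+ n)).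
  move=> h; rewrite -[P in LHS](poly_take_drop n) hornerD hornerM hornerXn.
  rewrite (_ : take_poly n P = 0) ?horner0 ?add0r//.
  by apply/polyP => m; rewrite coef_take_poly coef0; case: ifP => // /P0.
rewrite -[n in isO _ n]add0n; apply: isOM; last exact: isOX.
by apply: isO_continuous => //; exact: continuous_horner.
Qed.

(** Once the lower coefficients vanish, the coefficient of [h^m] is the limit of [P.[h] / h^m] at
    [0+], and the bound forces that limit to be 0. *)
Lemma isO_unique (R : realType) n (P : {poly R}) :
  isO 0^'+ n (fun h => P.[h]) -> forall m, (m < n)%N -> P`_m = 0.
Proof.
move=> [M PM] m; elim/ltn_ind: m => m IH mn.
have PE h : P.[h] = (drop_poly m P).[h] * h ^+ m.
  rewrite -[P in LHS](poly_take_drop m) hornerD hornerM hornerXn.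
  rewrite (_ : take_poly m P = 0) ?horner0 ?add0r//.
  apply/polyP => k; rewrite coef_take_poly coef0; case: ifP => // km.
  by rewrite IH// (ltn_trans km).
rewrite -[m]add0n -coef_drop_poly -horner_coef0.
have c1 : (drop_poly m P).[h] @[h --> 0^'+] --> (drop_poly m P).[0].
  apply: cvg_at_right_filter; exact: continuous_horner.
have c2 : (drop_poly m P).[h] @[h --> 0^'+] --> (0 : R).
  apply/cvgr0Pnorm_le => e e0; near=> h.
  have h0 : 0 < h by [].
  have h1 : h <= 1 by near: h; exact: nbhs_right_le.
  have : `|P.[h]| <= M * `|h| ^+ n by near: h.
  rewrite PE normrM normrX (gtr0_norm h0) -(subnK mn) exprD exprS mulrA mulrA.
  rewrite ler_pM2r ?exprn_gt0// => /le_trans; apply.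
  have h0' := ltW h0.
  rewrite (@le_trans _ _ (`|M| * h))//.
    rewrite mulrA ler_wpM2r//.
    rewrite (@le_trans _ _ (`|M| * h ^+ (n - m.+1)))//.
      by rewrite ler_wpM2r ?ler_norm// exprn_ge0.
    by rewrite ler_piMr// exprn_ile1.
  rewrite (@le_trans _ _ ((`|M| + 1) * h))//.
    by rewrite ler_wpM2r// lerDl.
  rewrite -ler_pdivlMl ?ltr_wpDl//.
  by near: h; apply: nbhs_right_le; rewrite mulr_gt0 ?invr_gt0 ?ltr_wpDl.
by apply: cvg_unique c2 => //; exact: norm_hausdorff.
Unshelve. all: by end_near. Qed.

(** * Interpolatory differentiation *)

Lemma zrange_uniq a b : uniq (zrange a b).
Proof.
by rewrite map_inj_uniq ?iota_uniq// => m n /addrI [].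
Qed.

Lemma size_stencil p : size (stencil p) = (2 * p)%N.
Proof. by rewrite size_map size_iota; lia. Qed.

Lemma lagrange_basis_at (R : realType) (s : seq int) j q : uniq s ->
  j \in s -> q \in s -> (lagrange_basis R s j).[q%:~R] = (j == q)%:R.
Proof.
move=> us js qs; rewrite horner_prod.
have [<-|jq] := eqVneq j q.
  apply: big1_seq => r /andP[rj _].
  rewrite hornerZ hornerXsubC -rmorphB/= mulVf// intr_eq0 subr_eq0.
  by rewrite eq_sym.
rewrite (big_rem q)//= eq_sym jq hornerZ hornerXsubC subrr mulr0 mul0r//.
Qed.

Lemma size_lagrange_basis (R : realType) (s : seq int) j : j \in s ->
  (size (lagrange_basis R s j) <= size s)%N.
Proof.
move=> js; suff: (size (lagrange_basis R s j) <= (count (predC1 j) s).+1)%N.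
  move=> /leq_trans; apply; rewrite -(count_predC (pred1 j) s) -add1n leq_add2r.
  by rewrite -has_count has_pred1.
rewrite /lagrange_basis; elim: s {js} => [|r s IH].
  by rewrite big_nil size_poly1.
rewrite big_cons /=; case: ifP => // _.
have : (size ((j - r)%:~R^-1 *: ('X - (r%:~R)%:P) : {poly R}) <= 2)%N.
  by rewrite (leq_trans (size_scale_leq _ _))// size_XsubC.
move=> s2; rewrite (leq_trans (size_polyMleq _ _))//.
by rewrite -subn1 leq_subLR (leq_trans (leq_add s2 IH)) ?add1n ?add2n.
Qed.

(** Both sides have degree below the number of nodes and agree at the nodes, so their difference has
    too many roots. *)
Lemma lagrange_interpolation (R : realType) (s : seq int) (g : {poly R}) :
  uniq s -> (size g <= size s)%N ->
  \sum_(j <- s) g.[j%:~R] *: lagrange_basis R s j = g.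
Proof.
move=> us gs; apply/subr0_eq.
apply: (@roots_geq_poly_eq0 _ _ [seq j%:~R | j : int <- s]).
- apply/allP => _ /mapP[q qs ->]; rewrite /root hornerD hornerN horner_sum.
  rewrite (bigD1_seq q)//= hornerZ lagrange_basis_at// eqxx mulr1.
  rewrite big1_seq ?addr0 ?subrr// => j /andP[jq js].
  by rewrite hornerZ lagrange_basis_at// (negPf jq) mulr0.
- by rewrite map_inj_uniq//; exact: intr_inj.
- rewrite size_map (leq_trans (size_polyD _ _))// geq_max size_polyN gs andbT.
  rewrite (leq_trans (size_sum _ _ _))//; apply/bigmax_leqP_seq => j js _.
  by rewrite (leq_trans (size_scale_leq _ _))// size_lagrange_basis.
Qed.

Lemma gamma_exact (R : realType) p k (q : int) (g : {poly R}) :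
  (size g <= 2 * p)%N ->
  \sum_(s <- stencil p) gamma R p k q s * g.[s%:~R] = g^`(k).[q%:~R].
Proof.
move=> g2p; have := @lagrange_interpolation R (stencil p) g (zrange_uniq _ _).
rewrite size_stencil => /(_ g2p) {2}<-.
rewrite raddf_sum /= horner_sum; apply: eq_bigr => j _.
by rewrite derivnZ hornerZ mulrC.
Qed.

Lemma delta1_exact (R : realType) p (g : {poly R}) :
  (size g <= (2 * p).+1)%N ->
  \sum_(s <- zrange (- p%:Z) p%:Z) delta1 R p s * g.[s%:~R] = g^`().[0].
Proof.
move=> g2p.
have := @lagrange_interpolation R (zrange (- p%:Z) p%:Z) g (zrange_uniq _ _).
rewrite size_map size_iota (_ : `|_|%N = (2 * p).+1); last by lia.
move=> /(_ g2p) {2}<-.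
rewrite raddf_sum /= horner_sum; apply: eq_bigr => j _.
by rewrite derivZ hornerZ mulrC.
Qed.

Lemma summation_by_parts (R : pzRingType) n (d g : nat -> R) :
  \sum_(0 <= m < n) (\sum_(m.+1 <= i < n.+1) d i) * (g m.+1 - g m) =
  \sum_(0 <= i < n.+1) d i * (g i - g 0%N).
Proof.
elim: n => [|n IH]; first by rewrite big_geq// big_nat1 subrr mulr0.
rewrite big_nat_recr//= big_nat1 [RHS]big_nat_recr//= -IH.
have E m : (0 <= m < n)%N ->
    (\sum_(m.+1 <= i < n.+2) d i) * (g m.+1 - g m) =
    (\sum_(m.+1 <= i < n.+1) d i) * (g m.+1 - g m) + d n.+1 * (g m.+1 - g m).
  by move=> /andP[_ mn]; rewrite big_nat_recr//= ?mulrDl// ltnW.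
rewrite (eq_big_nat _ _ E) big_split/= -mulr_sumr telescope_sumr// -addrA; congr (_ + _).
by rewrite -mulrDr addrC subrKA.
Qed.

(** The partial sums in [gamma_half] are the Abel coefficients of [delta1]. Abel summation leaves
    the boundary value [g (- p)] times the sum of all [delta1], and that sum vanishes. *)
Lemma gamma_half_parts (R : realType) p (g : int -> R) : (0 < p)%N ->
  \sum_(j <- stencil p) gamma_half R p j * (g j - g (j - 1)) =
  \sum_(j <- zrange (- p%:Z) p%:Z) delta1 R p j * g j.
Proof.
move=> p0; pose d m := delta1 R p (- p%:Z + m%:Z).
pose G m := g (- p%:Z + m%:Z).
have zrE (F : int -> R) a b n : b + 1 - a = n%:Z ->
    \sum_(j <- zrange a b) F j = \sum_(0 <= m < n) F (a + m%:Z).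
  by move=> E; rewrite /zrange E big_map absz_nat /index_iota subn0.
(* Exactness on the constant polynomial 1: the weights of a differentiation formula sum to 0. *)
have d0 : \sum_(0 <= m < (2 * p).+1) d m = 0.
  have /= := @delta1_exact R p 1; rewrite size_poly1 derivC horner0 => /(_ isT).
  rewrite (zrE _ _ _ (2 * p).+1); last by lia.
  by move=> E; rewrite -[RHS]E; apply: eq_bigr => m _; rewrite hornerC mulr1.
rewrite [RHS](zrE _ _ _ (2 * p).+1); last by lia.
transitivity (\sum_(0 <= i < (2 * p).+1) d i * (G i - G 0%N)); last first.
  under eq_bigr do rewrite mulrBr.
  by rewrite sumrB -mulr_suml d0 mul0r subr0.
rewrite -summation_by_parts (zrE _ _ _ (2 * p)%N); last by lia.
apply: eq_big_nat => m /andP[_ mp]; congr (_ * (g _ - g _)); last 2 first.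
- by lia.
- by lia.
rewrite /gamma_half (zrE _ _ _ (2 * p - m)%N); last by lia.
rewrite -[m.+1 in RHS]add0n [RHS]big_addn (_ : (2 * p).+1 - m.+1 = 2 * p - m)%N; last by lia.
by apply: eq_big_nat => i _; congr (delta1 _ _ _); lia.
Qed.

(** * Defects of the difference formulas in powers of the step *)

Lemma cvg_at_right0 (R : realType) : (0 : R)^'+ --> (0 : R).
Proof. exact: cvg_within. Qed.

Lemma coef_comp_scaleX (R : comNzRingType) (g : {poly R}) (a : R) m :
  (g \Po (a *: 'X))`_m = a ^+ m * g`_m.
Proof.
rewrite comp_polyE (eq_bigr (fun i : 'I_(size g) => (g`_i * a ^+ i) *: 'X^i)).
  rewrite -(poly_def _ (fun i => g`_i * a ^+ i)) coef_poly.
  by case: ltnP => [_|gm]; rewrite mulrC // nth_default ?mul0r.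
by move=> i _; rewrite exprZn scalerA.
Qed.

Lemma isO_horner (R : realType) (F : set_system R) (FF : Filter F) n
    (P : {poly R}) (a : R) :
  F --> (0 : R) -> (forall m, (m < n)%N -> P`_m = 0) ->
  isO F n (fun h => P.[a * h]).
Proof.
move=> F0 P0; apply: (@isO_ext _ _ _ _ (fun h => (P \Po (a *: 'X)).[h])).
  by move=> h; rewrite horner_comp hornerZ hornerX.
by apply: isO_poly => // m mn; rewrite coef_comp_scaleX P0// mulr0.
Qed.

(** Exactness is applied to the translate [(X + sigma)^m]. For [m = 0] the value of [m.-1] is
    immaterial because of [*+ m]. *)
Lemma stencil_power (R : realType) p (j sigma : int) m : (m < 2 * p)%N ->
  \sum_(s <- stencil p) gamma R p 1 j s * (sigma + s)%:~R ^+ m =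
  (sigma + j)%:~R ^+ m.-1 *+ m.
Proof.
move=> mp; have := @gamma_exact R p 1 j (('X - (- sigma%:~R)%:P) ^+ m).
rewrite size_exp_XsubC derivn1 deriv_exp derivXsubC mul1r hornerMn => /(_ mp).
rewrite horner_exp hornerXsubC opprK -intrD [j + _]addrC => <-.
by apply: eq_bigr => s _; rewrite horner_exp hornerXsubC opprK -intrD [s + _]addrC.
Qed.

(* At the first power that is not integrated exactly, the defect is still
   independent of the shift [sigma]. *)
Lemma stencil_power_top (R : realType) p (j sigma : int) : (0 < p)%N ->
  \sum_(s <- stencil p) gamma R p 1 j s * (sigma + s)%:~R ^+ (2 * p) -
    (sigma + j)%:~R ^+ (2 * p).-1 *+ (2 * p) =
  \sum_(s <- stencil p) gamma R p 1 j s * s%:~R ^+ (2 * p) -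
    j%:~R ^+ (2 * p).-1 *+ (2 * p).
Proof.
move=> p0; set n := (2 * p)%N.
pose P : {poly R} := ('X - (- sigma%:~R)%:P) ^+ n.
have sP : size P = n.+1 by rewrite size_exp_XsubC.
have mP : P \is monic by rewrite monic_exp// monicXsubC.
(* [(X + sigma)^n - X^n] has degree below [n], so the formula is exact on it; hence the defect on
   [X^n] is invariant under translation. *)
have sPX : (size (P - 'X^n)%R <= n)%N.
  apply/leq_sizeP => k; rewrite leq_eqVlt => /predU1P[<-|nk]; rewrite coefB coefXn.
    by rewrite eqxx -[X in P`_X]/(n.+1.-1) -sP -lead_coefE (monicP mP) subrr.
  by rewrite (gtn_eqF nk) nth_default ?subr0// sP.
have := @gamma_exact R p 1 j _ sPX.
rewrite derivn1 derivB deriv_exp derivXsubC mul1r derivXn hornerD hornerN !hornerMn.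
rewrite horner_exp hornerXsubC opprK hornerXn -intrD [j + _]addrC => E.
set A := \sum_(s <- _) _; set A0 := \sum_(s <- stencil p) _ * s%:~R ^+ _.
have /eqP : A - A0 = (sigma + j)%:~R ^+ n.-1 *+ n - j%:~R ^+ n.-1 *+ n.
  rewrite -E -sumrB; apply: eq_bigr => s _.
  by rewrite -mulrBr hornerD hornerN hornerXn horner_exp hornerXsubC opprK -intrD [s + _]addrC.
by rewrite subr_eq => /eqP ->; ring.
Qed.

Lemma stencil_deriv (R : realType) p (j : int) (g : {poly R}) : (0 < p)%N ->
  exists C, forall sigma : int, isO 0^'+ (2 * p).+1 (fun h =>
    \sum_(s <- stencil p) gamma R p 1 j s * g.[(sigma + s)%:~R * h] -
    h * g^`().[(sigma + j)%:~R * h] - C * h ^+ (2 * p)).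
Proof.
move=> p0; set n := (2 * p)%N.
(* The left side is a polynomial in [h] whose coefficients below [h^n] vanish by exactness; [C] is
   its coefficient of [h^n], the defect on [X^n] times [g_n]. *)
exists ((\sum_(s <- stencil p) gamma R p 1 j s * s%:~R ^+ n -
  j%:~R ^+ n.-1 *+ n) * g`_n) => sigma.
set C := (_ * g`_n).
pose P := \sum_(s <- stencil p) gamma R p 1 j s *: (g \Po ((sigma + s)%:~R *: 'X)) -
  (g^`() \Po ((sigma + j)%:~R *: 'X)) * 'X - C *: 'X^n.
apply: (@isO_ext _ _ _ _ (fun h => P.[h])).
  move=> h; rewrite !hornerD !hornerN hornerM hornerX hornerZ hornerXn.
  rewrite horner_sum horner_comp hornerZ hornerX [h * _]mulrC.
  congr (_ - _ - _); apply: eq_bigr => s _.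
  by rewrite hornerZ horner_comp hornerZ hornerX.
apply: isO_poly => [|m]; first exact: cvg_at_right0.
have -> : P`_m = (\sum_(s <- stencil p) gamma R p 1 j s * (sigma + s)%:~R ^+ m -
    (sigma + j)%:~R ^+ m.-1 *+ m) * g`_m - C * (m == n)%:R.
  rewrite !coefD !coefN coefZ coefXn coefMX coef_sum mulrBl.
  congr (_ - _ - _).
    rewrite mulr_suml; apply: eq_bigr => s _.
    by rewrite coefZ coef_comp_scaleX mulrA.
  case: m => [|m] /=; first by rewrite mulr0n mul0r.
  by rewrite coef_comp_scaleX coef_deriv mulrnAr mulrnAl.
rewrite ltnS leq_eqVlt => /predU1P[->|mn].
  by rewrite eqxx mulr1 stencil_power_top// subrr.
by rewrite stencil_power// subrr mul0r (ltn_eqF mn) mulr0 subrr.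
Qed.

(** One node more than in [stencil] makes the formula exact up to degree [2 * p], so that no term in
    [h^(2 * p)] is left. *)
Lemma delta_deriv (R : realType) p (g : {poly R}) :
  isO 0^'+ (2 * p).+1 (fun h =>
    \sum_(s <- zrange (- p%:Z) p%:Z) delta1 R p s * g.[s%:~R * h] - h * g^`().[0]).
Proof.
pose P := \sum_(s <- zrange (- p%:Z) p%:Z) delta1 R p s *: (g \Po (s%:~R *: 'X)) -
  g^`().[0] *: 'X.
apply: (@isO_ext _ _ _ _ (fun h => P.[h])).
  move=> h; rewrite hornerD hornerN hornerZ hornerX horner_sum [h * _]mulrC.
  congr (_ - _); apply: eq_bigr => s _.
  by rewrite hornerZ horner_comp hornerZ hornerX.
apply: isO_poly => [|m mp]; first exact: cvg_at_right0.
rewrite coefB coefZ coefX coef_sum horner_coef0 coef_deriv.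
have := @delta1_exact R p 'X^m; rewrite size_polyXn => /(_ mp).
rewrite derivXn hornerMn hornerXn => E.
rewrite (eq_bigr (fun s : int => (delta1 R p s * ('X^m).[s%:~R]) * g`_m)); last first.
  by move=> s _; rewrite coefZ coef_comp_scaleX hornerXn mulrA.
rewrite -mulr_suml E; case: m {mp E} => [|[|m]] /=.
- by rewrite mulr0n mul0r mulr0 subrr.
- by rewrite expr0 mul1r mulr1 mulr1n subrr.
- by rewrite expr0n mul0rn mul0r mulr0 subrr.
Qed.

(** Expanding [H] in time reduces the sum to the moments [kap m] of the weights. Those with [m < n]
    isolate the [k]-th coefficient, and the terms with [m > n] are negligible. The term [m = n]
    contains [H_n(a h) h^n], where [H_n(a h)] may be replaced by [H_n(0)] with an error [O(h)]: this
    is why [C] does not depend on [a]. *)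
Lemma time_quadrature (R : realType) p k (H : {poly {poly R}}) (lambda : R) :
  (k < 2 * p)%N ->
  exists C, forall a : R, isO 0^'+ (2 * p).+1 (fun h =>
    \sum_(r <- stencil p) gamma R p k 0 r * H.[(r%:~R * (lambda * h))%:P].[a * h] -
    k`!%:R * (lambda * h) ^+ k * (H`_k).[a * h] - C * h ^+ (2 * p)).
Proof.
move=> kp; set n := (2 * p)%N.
pose kap m := \sum_(r <- stencil p) gamma R p k 0 r * r%:~R ^+ m.
have kapE m : (m < n)%N -> kap m = (m == k)%:R * k`!%:R.
  move=> mn; have := @gamma_exact R p k 0 'X^m; rewrite size_polyXn => /(_ mn).
  rewrite derivnXn hornerMn hornerXn /kap => E.
  under eq_bigr do rewrite -hornerXn.
  rewrite E expr0n subn_eq0; case: ltngtP => [mk|km|->].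
  - by rewrite ffact_small// mulr0n mul0r.
  - by rewrite mul0rn mul0r.
  - by rewrite ffactnn mul1r.
exists (kap n * lambda ^+ n * (H`_n).[0]) => a.
(* [N] pads the coefficients of [H] so that the indices [k] and [n] both occur in the sum. *)
pose N := (size H + n.+1)%N.
pose t m h : R := kap m * (lambda * h) ^+ m * (H`_m).[a * h]
  - (m == k)%:R * (k`!%:R * (lambda * h) ^+ k * (H`_k).[a * h])
  - (m == n)%:R * (kap n * lambda ^+ n * (H`_n).[0] * h ^+ n).
apply: (@isO_ext _ _ _ _ (fun h => \sum_(m <- index_iota 0 N) t m h)).
  move=> h; rewrite /t !sumrB; congr (_ - _ - _).
  - under eq_bigr => r _.
      rewrite (@horner_coef_wide {poly R} N H); last by rewrite /N leq_addr.
      rewrite -(big_mkord xpredT (fun i => H`_i * _ ^+ i)) horner_sum mulr_sumr.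
      over.
    rewrite exchange_big /=; apply: eq_bigr => m _.
    rewrite /kap -mulrA mulr_suml; apply: eq_bigr => r _.
    by rewrite hornerM -polyC_exp hornerC exprMn; ring.
  - rewrite -mulr_suml -[LHS]mul1r; congr (_ * _).
    rewrite (bigD1_seq k) ?iota_uniq ?mem_index_iota//=; last by rewrite /N; lia.
    by rewrite eqxx big1 ?addr0// => i /negPf ->.
  - rewrite -mulr_suml -[LHS]mul1r; congr (_ * _).
    rewrite (bigD1_seq n) ?iota_uniq ?mem_index_iota//=; last by rewrite /N; lia.
    by rewrite eqxx big1 ?addr0// => i /negPf ->.
apply: isO_sum => m _; rewrite /t.
have [mn|nm|->] := ltngtP m n.
- apply: (@isO_ext _ _ _ _ (fun=> 0)); last exact: isO0.
  by move=> h; rewrite kapE//; case: eqP => [->|_] /=; ring.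
- apply: (@isO_le _ _ _ _ m) => //; first exact: cvg_at_right0.
  apply: (@isO_ext _ _ _ _ (fun h => (kap m * lambda ^+ m) * (h ^+ m * (H`_m).[a * h]))).
    move=> h; rewrite gtn_eqF ?exprMn/=; last exact: ltn_trans nm.
    by ring.
  apply: isOZ; rewrite -[m in isO _ m]addn0; apply: isOM; first exact: isOX.
  by apply: isO_horner => //; exact: cvg_at_right0.
- apply: (@isO_ext _ _ _ _ (fun h => (kap n * lambda ^+ n) *
    (h ^+ n * (H`_n - (H`_n).[0]%:P).[a * h]))).
    move=> h; rewrite gtn_eqF ?exprMn//= hornerD hornerN hornerC.
    by ring.
  apply: isOZ; rewrite -addn1; apply: isOM; first exact: isOX.
  apply: isO_horner; first exact: cvg_at_right0.
  by case=> // _; rewrite coefB coefC horner_coef0 subrr.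
Qed.

(** * Composition, and polynomials in space and time *)

(** A perturbation [C h^n] passes through [P] to first order only, and [P'] may be frozen at [u0]
    because [b - u0] is [O(h)]. The new coefficient of [h^n] then depends on [u0] and [C] alone. *)
Lemma isO_comp_poly (R : realType) (F : set_system R) (FF : Filter F) n
    (P : {poly R}) (v b : R -> R) (u0 C : R) :
  F --> (0 : R) -> (0 < n)%N ->
  isO F 1 (fun h => b h - u0) ->
  isO F n.+1 (fun h => v h - b h - C * h ^+ n) ->
  isO F n.+1 (fun h => P.[v h] - P.[b h] - P^`().[u0] * C * h ^+ n).
Proof.
move=> F0 n0 bO vO.
have vbO : isO F n (fun h => v h - b h).
  apply: (@isO_ext _ _ _ _ (fun h => (v h - b h - C * h ^+ n) + C * h ^+ n)).
    by move=> h; rewrite subrK.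
  by apply: isOD; [exact: isO_le vO|exact/isOZ/isOX].
have v1 : isO F 1 (fun h => v h - u0).
  apply: (@isO_ext _ _ _ _ (fun h => (v h - b h) + (b h - u0))).
    by move=> h; rewrite subrKA.
  by apply: isOD => //; exact: isO_le vbO.
have v00 : isO F 0 v.
  apply: (@isO_ext _ _ _ _ (fun h => (v h - u0) + u0)).
    by move=> h; rewrite subrK.
  by apply: isOD; [exact: isO_le v1|exact: isOC].
have b00 : isO F 0 b.
  apply: (@isO_ext _ _ _ _ (fun h => (b h - u0) + u0)).
    by move=> h; rewrite subrK.
  by apply: isOD; [exact: isO_le bO|exact: isOC].
(* The Horner induction on [P] also needs that [P(b)] is bounded and that [P(b) - P(u0)] is
   [O(h)]. *)
suff : isO F n.+1 (fun h => P.[v h] - P.[b h] - P^`().[u0] * C * h ^+ n) /\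
    isO F 0 (fun h => P.[b h]) /\ isO F 1 (fun h => P.[b h] - P.[u0]) by case.
elim/poly_ind: P => [|P c [IH1 [IH2 IH3]]].
  by split; [|split]; (apply: (@isO_ext _ _ _ _ (fun=> 0)); last exact: isO0) => h;
    rewrite ?deriv0 !horner0 ?mul0r ?subrr.
split; [|split].
- apply: (@isO_ext _ _ _ _ (fun h =>
      (P.[v h] - P.[b h] - P^`().[u0] * C * h ^+ n) * v h +
      P.[b h] * (v h - b h - C * h ^+ n) +
      (P^`().[u0] * C) * (h ^+ n * (v h - u0)) +
      C * (h ^+ n * (P.[b h] - P.[u0])))).
    move=> h; rewrite derivMXaddC !(hornerD, hornerM, hornerX, hornerC); ring.
  apply: isOD; last first.
    by apply: isOZ; rewrite -addn1; apply: isOM => //; exact: isOX.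
  apply: isOD; last first.
    by apply: isOZ; rewrite -addn1; apply: isOM => //; exact: isOX.
  apply: isOD; last by rewrite -[n.+1]add0n; exact: isOM.
  by rewrite -[n.+1]addn0; exact: isOM.
- apply: (@isO_ext _ _ _ _ (fun h => P.[b h] * b h + c)).
    by move=> h; rewrite !(hornerD, hornerM, hornerX, hornerC).
  by apply: isOD; [exact: (isOM FF (m := 0))|exact: isOC].
- apply: (@isO_ext _ _ _ _ (fun h => P.[b h] * (b h - u0) + u0 * (P.[b h] - P.[u0]))).
    by move=> h; rewrite !(hornerD, hornerM, hornerX, hornerC); ring.
  by apply: isOD; [exact: (isOM FF (m := 0))|exact: isOZ].
Qed.

Lemma isO_comp (R : realType) (F : set_system R) (FF : Filter F) n
    (e v : R -> R) (u0 : R) :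
  F --> (0 : R) ->
  isO (nbhs (0 : R)) n (fun y => e (u0 + y)) ->
  isO F 1 (fun h => v h - u0) -> isO F n (fun h => e (v h)).
Proof.
move=> F0 [M [d /= d0 eM]] [N vN]; exists (`|M| * `|N| ^+ n); near=> h.
have vu : `|v h - u0| <= `|N| * `|h|.
  rewrite (@le_trans _ _ (N * `|h|))//; first by near: h; rewrite -[in X in X _]/(`|_| ^+ 1).
  by rewrite ler_wpM2r// ler_norm.
have := eM (v h - u0); rewrite /= sub0r normrN subrKC => /(_ _)/le_trans; apply.
  rewrite (le_lt_trans vu)// (@le_lt_trans _ _ ((`|N| + 1) * `|h|))//.
    by rewrite ler_wpM2r// lerDl.
  rewrite -ltr_pdivlMl ?ltr_wpDl//; near: h; apply: F0.
  exists ((`|N| + 1)^-1 * d); first by rewrite /= mulr_gt0 ?invr_gt0 ?ltr_wpDl.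
  by move=> h /=; rewrite sub0r normrN.
rewrite (@le_trans _ _ (`|M| * `|v h - u0| ^+ n))//.
  by rewrite ler_wpM2r ?ler_norm.
by rewrite -mulrA ler_wpM2l// -exprMn lerXn2r// nnegrE// mulr_ge0.
Unshelve. all: by end_near. Qed.

Lemma horner2_comp (R : comNzRingType) (P : {poly R}) (Q : {poly {poly R}}) x y :
  ((map_poly polyC P) \Po Q).[y%:P].[x] = P.[Q.[y%:P].[x]].
Proof.
by rewrite horner_comp -[(map_poly _ _).[_]]/(P \Po _) horner_comp.
Qed.

(** This is why the predictor of level [k] may stop its Taylor sum at [l = k]: the later time
    coefficients do not affect the [k]-th coefficient of the composite. *)
Lemma coef_comp_eq (R : comNzRingType) (P A B : {poly R}) k :
  (forall m, (m <= k)%N -> A`_m = B`_m) ->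
  forall m, (m <= k)%N -> (P \Po A)`_m = (P \Po B)`_m.
Proof.
move=> AB; elim/poly_ind: P => [|P c IH] m mk; first by rewrite !comp_poly0.
rewrite !comp_poly_MXaddC !coefD; congr (_ + _); rewrite !coefM.
by apply: eq_bigr => i _; have := ltn_ord i => im; rewrite IH ?AB//; lia.
Qed.

(** [map_poly (@deriv R)] differentiates in the inner variable, space; [deriv] on [{poly {poly R}}]
    differentiates in the outer one, time. *)
Lemma map_derivM (R : comNzRingType) (A B : {poly {poly R}}) :
  map_poly (@deriv R) (A * B) =
  map_poly (@deriv R) A * B + A * map_poly (@deriv R) B.
Proof.
apply/polyP => m; rewrite coefD coef_map !coefM raddf_sum -big_split /=.
by apply: eq_bigr => i _; rewrite derivM !coef_map.
Qed.

Lemma map_deriv_comp (R : comNzRingType) (P : {poly R}) (Q : {poly {poly R}}) :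
  map_poly (@deriv R) (map_poly polyC P \Po Q) =
  (map_poly polyC P^`() \Po Q) * map_poly (@deriv R) Q.
Proof.
elim/poly_ind: P => [|P c IH].
  by rewrite deriv0 !rmorph0 ?comp_poly0 mul0r ?raddf0.
have mE (p q : {poly R}) : map_poly polyC (p + q * 'X) =
    map_poly polyC p + map_poly polyC q * 'X.
  by rewrite rmorphD rmorphM /= map_polyX.
rewrite derivMXaddC [P * 'X + _]addrC !mE map_polyC /=.
rewrite !comp_polyD !comp_polyM !comp_polyX comp_polyC raddfD /= map_derivM IH.
by rewrite map_polyC /= derivC add0r mulrDl mulrAC addrC.
Qed.

(** * Directional derivatives *)

(** Hides the cast to [R^o], so that a derivative is again a plain function [V -> R] and can be
    iterated. *)
Definition dird (R : realType) (V : normedModType R) (v : V) (g : V -> R) : V -> R :=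
  'D_v (g : V -> R^o).

Lemma is_derive_ray (R : realType) (V : normedModType R) (g : V -> R) (z v : V) (s : R) :
  derivable (g : V -> R^o) (z + s *: v) v ->
  is_derive s (1 : R) (fun s : R => g (z + s *: v) : R^o) (dird v g (z + s *: v)).
Proof.
have E : (fun h : R => h^-1 *: ((g (z + (h *: (1 : R^o) + s) *: v) : R^o) - g (z + s *: v))) =
    (fun h : R => h^-1 *: ((g (h *: v + (z + s *: v)) : R^o) - g (z + s *: v))).
  apply/funext => h; congr (_ *: (g _ - _)).
  by rewrite -[h *: (1 : R^o)]/(h * 1) mulr1 scalerDl addrCA.
by move=> gd; split; [rewrite /derivable|rewrite /dird /derive]; rewrite E.
Qed.

Lemma ray_nbhs (R : realType) (V : normedModType R) (P : set V) (z v w : V) :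
  nbhs z P -> exists2 d : R, 0 < d &
    forall s t : R, `|s| < d -> `|t| < d -> P (z + s *: v + t *: w).
Proof.
move=> /nbhs_ballP[e /= e0 zP]; exists (e / (`|v| + `|w| + 1)).
  by rewrite divr_gt0// ltr_wpDl// addr_ge0.
move=> s t sd td; apply: zP; rewrite -ball_normE /= opprD addrA opprD addrA subrr add0r.
rewrite -opprD normrN (le_lt_trans (ler_normD _ _))// !normrZ.
set d := e / _ in sd td.
rewrite (@le_lt_trans _ _ (d * `|v| + d * `|w|))//.
  by rewrite lerD// ler_wpM2r// ltW.
rewrite -mulrDr /d mulrAC ltr_pdivrMr; last by rewrite ltr_wpDl// addr_ge0.
by rewrite ltr_pM2l// ltrDl.
Qed.

Lemma MVT_ray (R : realType) (g dg : R -> R) (h : R) : 0 < h ->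
  (forall s : R, `|s| <= h -> is_derive s (1 : R) (g : R -> R^o) (dg s)) ->
  exists2 xi : R, `|xi| < h & g h - g 0 = h * dg xi.
Proof.
move=> h0 gd.
have [||xi] := @MVT R g dg 0 h h0.
- move=> s; rewrite in_itv/= => /andP[s0 sh]; apply: gd.
  by rewrite ger0_norm ltW.
- apply: derivable_within_continuous => s; rewrite in_itv/= => /andP[s0 sh].
  by apply: ex_derive; apply: gd; rewrite ger0_norm.
- rewrite in_itv/= => /andP[s0 sh] E; exists xi; first by rewrite ger0_norm// ltW.
  by rewrite E subr0 mulrC.
Qed.

(** The mean value theorem on either side of 0 bounds the increment by [|h|] times a bound of [dg]
    between 0 and [h]. Each use raises the order of a Taylor remainder by one. *)
Lemma isO_primitive (R : realType) n (g dg : R -> R) :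
  (\forall h \near nbhs (0 : R), is_derive h (1 : R) (g : R -> R^o) (dg h)) ->
  isO (nbhs (0 : R)) n dg -> isO (nbhs (0 : R)) n.+1 (fun h => g h - g 0).
Proof.
move=> [d /= d0 gd] [M [e /= e0 dgM]]; exists `|M|; exists (Num.min d e) => /=.
  by rewrite lt_min d0.
move=> h /=; rewrite sub0r normrN lt_min => /andP[hd he].
have gd' s : `|s| <= `|h| -> is_derive s (1 : R) (g : R -> R^o) (dg s).
  by move=> sh; apply: gd; rewrite /= sub0r normrN (le_lt_trans sh).
have bd s : `|s| <= `|h| -> `|dg s| <= `|M| * `|h| ^+ n.
  move=> sh; rewrite (@le_trans _ _ (M * `|s| ^+ n))//.
    by apply: dgM; rewrite /= sub0r normrN (le_lt_trans sh).
  rewrite (@le_trans _ _ (`|M| * `|s| ^+ n))// ?ler_wpM2r ?ler_norm//.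
  by rewrite ler_wpM2l// lerXn2r// nnegrE.
have gc a b : (forall s, s \in `[a, b]%R -> `|s| <= `|h|) -> {within `[a, b], continuous g}.
  move=> sab; apply: derivable_within_continuous => s sI.
  by have gds := gd' s (sab s sI); exact: ex_derive.
have [h0|h0] := leP 0 h.
- have [||c] := @MVT_segment R g dg 0 h h0.
  + move=> s; rewrite in_itv/= => /andP[s0 sh]; apply: gd'.
    by rewrite !ger0_norm// ltW.
  + by apply: gc => s; rewrite in_itv/= => /andP[s0 sh]; rewrite !ger0_norm.
  + rewrite in_itv/= => /andP[s0 sh] ->; rewrite subr0 normrM exprSr mulrA.
    by rewrite ler_wpM2r// bd// !ger0_norm.
- have [||c] := @MVT_segment R g dg h 0 (ltW h0).
  + move=> s; rewrite in_itv/= => /andP[s0 sh]; apply: gd'.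
    by rewrite !ler0_norm ?lerN2// ltW.
  + apply: gc => s; rewrite in_itv/= => /andP[s0 sh].
    by rewrite !ler0_norm ?lerN2// ltW.
  + rewrite in_itv/= => /andP[s0 sh] E; rewrite -normrN opprB E sub0r normrM normrN.
    rewrite exprSr mulrA ler_wpM2r// bd// !ler0_norm ?lerN2//; exact: ltW.
Qed.

Lemma class_C_cont (R : realType) (V : normedModType R) k (A : set V) (g : V -> R) a :
  class_C k A g -> A a -> {for a, continuous g}.
Proof. by case: k => [|k] [+ _]; exact. Qed.

Lemma class_C_derivable (R : realType) (V : normedModType R) k (A : set V) (g : V -> R) v a :
  class_C k.+1 A g -> A a -> derivable (g : V -> R^o) a v.
Proof. by move=> [_ /(_ v)[+ _]]; exact. Qed.

Lemma class_C_dird (R : realType) (V : normedModType R) k (A : set V) (g : V -> R) v :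
  class_C k.+1 A g -> class_C k A (dird v g).
Proof. by move=> [_ /(_ v)[_ +]]; exact. Qed.

Lemma class_CW (R : realType) (V : normedModType R) j k (A : set V) (g : V -> R) :
  (j <= k)%N -> class_C k A g -> class_C j A g.
Proof.
elim: j k g => [|j IH] [|k] g// jk [gc gd]; split => // v.
by have [gv gk] := gd v; split => //; exact: IH gk.
Qed.

Lemma eq_closeness (R : realType) (c x y : R) :
  (forall e : R, 0 < e -> `|x - y| <= c * e) -> x = y.
Proof.
move=> xy; apply/eqP; rewrite -subr_eq0 -normr_le0; apply/ler_addgt0Pl => e e0.
rewrite addr0 (le_trans (xy (e / (`|c| + 1)) _))//.
  by rewrite divr_gt0// ltr_wpDl.
rewrite mulrA ler_pdivrMr ?ltr_wpDl// mulrC ler_pM2l//.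
by rewrite (le_trans (ler_norm _))// lerDl.
Qed.

Lemma close_trans2 (R : realType) (x y w e : R) :
  `|w - x| <= e -> `|w - y| <= e -> `|x - y| <= 2 * e.
Proof. by rewrite !ler_norml => /andP[? ?] /andP[? ?]; apply/andP; split; lra. Qed.

Lemma close_trans3 (R : realType) (x y x1 y1 w e : R) :
  `|x1 - x| <= e -> `|y1 - y| <= e -> `|x1 + y1 - w| <= e -> `|w - (x + y)| <= 3 * e.
Proof.
by rewrite !ler_norml => /andP[? ?] /andP[? ?] /andP[? ?]; apply/andP; split; lra.
Qed.

Lemma nbhs_close (R : realType) (V : normedModType R) (g : V -> R) (z : V) (e : R) :
  0 < e -> {for z, continuous g} -> nbhs z [set y | `|g y - g z| <= e].
Proof.
move=> e0 /cvgr_dist_le /(_ e e0) gz; near=> y => /=.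
by rewrite distrC; near: y.
Unshelve. all: by end_near. Qed.

Lemma half_radius (R : realType) (d : R) : 0 < d ->
  exists2 h : R, 0 < h & forall s : R, `|s| <= h -> `|s| < d.
Proof.
move=> d0; exists (d / 2); first by rewrite divr_gt0.
by move=> s /le_lt_trans; apply; rewrite ltr_pdivrMr// ltr_pMr// ltrDl.
Qed.

(** The increment of [g] from [z] to [z + h (v + w)] is computed along the diagonal and along the
    other two sides of a triangle. Mean values on the three segments give an identity between
    derivatives near [z]; continuity moves it to [z], at the cost of three errors [e]. *)
Lemma dirdD (R : realType) (V : normedModType R) (A : set V) (g : V -> R) v w z :
  open A -> class_C 1 A g -> A z -> dird (v + w) g z = dird v g z + dird w g z.
Proof.
move=> oA gC Az; apply: (@eq_closeness _ 3) => e e0.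
have dc t : {for z, continuous (dird t g)}.
  by apply: class_C_cont Az; exact: class_C_dird gC.
pose P := A `&` [set y | `|dird v g y - dird v g z| <= e]
  `&` [set y | `|dird w g y - dird w g z| <= e]
  `&` [set y | `|dird (v + w) g y - dird (v + w) g z| <= e].
have nP : nbhs z P.
  by do 3![apply: filterI; last by apply: nbhs_close => //; exact: dc];
    exact: open_nbhs_nbhs.
have [d d0 dP] := ray_nbhs v w nP.
have PA s t : `|s| < d -> `|t| < d -> A (z + s *: v + t *: w).
  by move=> sd td; have [[[]]] := dP s t sd td.
have [h h0 hd] := half_radius d0.
have z0 : `|0 : R| < d by rewrite normr0.
have hh : `|h| < d by apply: hd; rewrite gtr0_norm.
have D1 t y : A y -> derivable (g : V -> R^o) y t.
  exact: (class_C_derivable gC).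
have PA1 s : `|s| < d -> A (z + s *: v).
  by move=> sd; have := PA s 0 sd z0; rewrite scale0r addr0.
have PA2 s : `|s| < d -> A (z + s *: (v + w)).
  by move=> sd; rewrite scalerDr addrA; exact: PA.
have [x1 x1h E1] := @MVT_ray R (fun s => g (z + s *: v)) (fun s => dird v g (z + s *: v)) h h0
  (fun s sh => is_derive_ray (D1 v _ (PA1 s (hd s sh)))).
have [x2 x2h E2] := @MVT_ray R (fun s => g (z + h *: v + s *: w)) (fun s => dird w g (z + h *: v + s *: w)) h h0
  (fun s sh => is_derive_ray (D1 w _ (PA _ _ hh (hd s sh)))).
have [x3 x3h E3] := @MVT_ray R (fun s => g (z + s *: (v + w))) (fun s => dird (v + w) g (z + s *: (v + w))) h h0
  (fun s sh => is_derive_ray (D1 _ _ (PA2 s (hd s sh)))).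
have E : dird (v + w) g (z + x3 *: (v + w)) =
   dird v g (z + x1 *: v) + dird w g (z + h *: v + x2 *: w).
  apply: (mulfI (lt0r_neq0 h0)); rewrite mulrDr -E1 -E2 -E3 !scale0r !addr0 scalerDr addrA.
  by ring.
have [[[_ P1] _] _] := dP _ _ (hd _ (ltW x1h)) z0.
have [[[_ _] P2] _] := dP _ _ hh (hd _ (ltW x2h)).
have [[[_ _] _] P3] := dP _ _ (hd _ (ltW x3h)) (hd _ (ltW x3h)).
rewrite /= scale0r addr0 in P1; rewrite /= in P2; rewrite /= -addrA -scalerDr E in P3.
exact: close_trans3 P1 P2 P3.
Qed.

Lemma dirdZ (R : realType) (V : normedModType R) (A : set V) (g : V -> R) (a : R) v z :
  class_C 1 A g -> A z -> dird (a *: v) g z = a * dird v g z.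
Proof.
move=> gC Az.
have d0 t : is_derive (0 : R) (1 : R) (fun s : R => g (z + s *: t) : R^o) (dird t g z).
  have := @is_derive_ray R V g z t 0; rewrite scale0r addr0; apply.
  exact: class_C_derivable gC Az.
have da : is_derive (0 : R) (1 : R) (fun s : R => s * a) a.
  by apply: is_derive_eq; rewrite scaler0 add0r -[_ *: _]/(_ * _) mulr1.
have dv : is_derive (0 * a) (1 : R) (fun s : R => g (z + s *: v) : R^o) (dird v g z).
  by rewrite mul0r.
have := @is_derive1_comp R _ _ 0 _ _ dv da.
have -> : (fun s : R => g (z + s *: v) : R^o) \o (fun s : R => s * a) =
    (fun s : R => g (z + s *: (a *: v)) : R^o).
  by apply/funext => s /=; rewrite scalerA.
by move=> dc; have [_ <-] := d0 (a *: v); have [_ ->] := dc; rewrite mulrC.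
Qed.

Lemma second_difference (R : realType) (V : normedModType R) (g : V -> R) v w z (h : R) :
  0 < h ->
  (forall s t, `|s| <= h -> `|t| <= h -> derivable (g : V -> R^o) (z + s *: v + t *: w) v) ->
  (forall s t, `|s| <= h -> `|t| <= h ->
    derivable (dird v g : V -> R^o) (z + s *: v + t *: w) w) ->
  exists x y, [/\ `|x| <= h, `|y| <= h &
    g (z + h *: v + h *: w) - g (z + h *: v) - (g (z + h *: w) - g z) =
    h * (h * dird w (dird v g) (z + x *: v + y *: w))].
Proof.
move=> h0 d1 d2.
have hh : `|h| <= h by rewrite gtr0_norm.
have z0 : `|0 : R| <= h by rewrite normr0 ltW.
(* The mean value theorem is applied in the direction [v] to the increment along [w], and then in
   the direction [w] to the derivative so obtained. *)
have [s sh|x xh E] := @MVT_ray R (fun s => g (z + h *: w + s *: v) - g (z + s *: v))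
  (fun s => dird v g (z + h *: w + s *: v) - dird v g (z + s *: v)) h h0.
  apply: is_deriveB; apply: is_derive_ray.
    by rewrite addrAC; exact: d1.
  by have := d1 s 0 sh z0; rewrite scale0r addr0.
have [t th|y yh E2] := @MVT_ray R (fun t => dird v g (z + x *: v + t *: w))
  (fun t => dird w (dird v g) (z + x *: v + t *: w)) h h0.
  by apply: is_derive_ray; apply: d2 => //; exact: ltW.
exists x, y; split; [exact: ltW|exact: ltW|].
move: E2; rewrite scale0r addr0 => <-.
by move: E; rewrite scale0r !addr0 [z + h *: w + _]addrAC [z + h *: w + _]addrAC => ->.
Qed.

(** The second difference over a small parallelogram is symmetric in [v] and [w]. Its two mean value
    expressions are therefore equal after division by [h^2], and each is within [e] of the
    corresponding mixed derivative at [z]. *)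
Lemma schwarz (R : realType) (V : normedModType R) (A : set V) (g : V -> R) v w z :
  open A -> class_C 2 A g -> A z -> dird w (dird v g) z = dird v (dird w g) z.
Proof.
move=> oA gC Az; apply: (@eq_closeness _ 2) => e e0.
have dc s t : {for z, continuous (dird t (dird s g))}.
  have C1 : class_C 1 A (dird s g) by exact: class_C_dird gC.
  have C0 : class_C 0 A (dird t (dird s g)) by exact: class_C_dird C1.
  exact: class_C_cont C0 Az.
pose P := A `&` [set y | `|dird w (dird v g) y - dird w (dird v g) z| <= e]
  `&` [set y | `|dird v (dird w g) y - dird v (dird w g) z| <= e].
have nP : nbhs z P.
  by do 2![apply: filterI; last by apply: nbhs_close => //; exact: dc];
    exact: open_nbhs_nbhs.
have [d d0 dP] := ray_nbhs v w nP.
have PA s t : `|s| < d -> `|t| < d -> A (z + s *: v + t *: w).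
  by move=> sd td; have [[]] := dP s t sd td.
have [h h0 hd] := half_radius d0.
have D1 t y : A y -> derivable (g : V -> R^o) y t.
  exact: (class_C_derivable gC).
have D2 s t y : A y -> derivable (dird s g : V -> R^o) y t.
  exact: (class_C_derivable (class_C_dird s gC)).
have [x [y [xh yh E]]] := second_difference h0
  (fun s t sh th => D1 v _ (PA s t (hd _ sh) (hd _ th)))
  (fun s t sh th => D2 v w _ (PA s t (hd _ sh) (hd _ th))).
have PA' s t : `|t| < d -> `|s| < d -> A (z + s *: w + t *: v).
  by move=> sd td; rewrite addrAC; exact: PA.
have [y' [x' [yh' xh' E']]] := second_difference h0
  (fun s t sh th => D1 w _ (PA' s t (hd _ th) (hd _ sh)))
  (fun s t sh th => D2 w v _ (PA' s t (hd _ th) (hd _ sh))).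
have LL : g (z + h *: v + h *: w) - g (z + h *: v) - (g (z + h *: w) - g z) =
    g (z + h *: w + h *: v) - g (z + h *: w) - (g (z + h *: v) - g z).
  by rewrite [z + h *: w + _]addrAC; ring.
have hI := @mulfI R h (lt0r_neq0 h0).
have EE := hI _ _ (hI _ _ (etrans (esym E) (etrans LL E'))).
rewrite [z + y' *: w + _]addrAC in EE.
have [[_ P1] _] := dP _ _ (hd _ xh) (hd _ yh).
have [[_ _] P2] := dP _ _ (hd _ xh') (hd _ yh').
rewrite /= EE in P1; rewrite /= in P2.
exact: close_trans2 P1 P2.
Qed.

(** * Taylor polynomials *)

Lemma class_C_iter (R : realType) (V : normedModType R) j k (A : set V) (g : V -> R) v :
  class_C (j + k) A g -> class_C k A (iter j (dird v) g).
Proof.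
elim: j k => [//|j IH] k; rewrite addSnnS => /IH gC /=.
exact: class_C_dird gC.
Qed.

Lemma eq_in_dird (R : realType) (V : normedModType R) (A : set V) (g g' : V -> R) v :
  open A -> (forall y, A y -> g y = g' y) ->
  forall y, A y -> dird v g y = dird v g' y.
Proof.
move=> oA gg y Ay; apply: near_eq_derive.
by apply: filterS (open_nbhs_nbhs (conj oA Ay)); exact: gg.
Qed.

Lemma eq_in_iter_dird (R : realType) (V : normedModType R) (A : set V) (g g' : V -> R) v i :
  open A -> (forall y, A y -> g y = g' y) ->
  forall y, A y -> iter i (dird v) g y = iter i (dird v) g' y.
Proof. by move=> oA gg; elim: i => //= i IH; exact: eq_in_dird. Qed.

Lemma iter_dird_comm (R : realType) (V : normedModType R) (A : set V) (g : V -> R) v w j :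
  open A -> class_C j.+1 A g -> forall y, A y ->
  iter j (dird w) (dird v g) y = dird v (iter j (dird w) g) y.
Proof.
move=> oA; elim: j => [//|j IH] gC y Ay /=.
have gC1 : class_C j.+1 A g := @class_CW R V j.+1 j.+2 A g (leqnSn _) gC.
rewrite (eq_in_dird w oA (IH gC1) Ay).
have gC2 : class_C 2 A (iter j (dird w) g).
  by apply: (@class_C_iter R V j 2); rewrite addn2.
exact: schwarz oA gC2 Ay.
Qed.

(** Derivatives along [e2] are taken first: replacing [g] by [dird e2 g] then merely shifts [j],
    while for [dird e1 g] the mixed derivatives have to be commuted. *)
Definition tcoef (R : realType) (V : normedModType R) (e1 e2 z : V) (g : V -> R)
    (i j : nat) : R :=
  iter i (dird e1) (iter j (dird e2) g) z / (i`! * j`!)%:R.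

Lemma divr_mulSn (R : realType) (x : R) k m : x / (k.+1 * m)%:R *+ k.+1 = x / m%:R.
Proof.
by rewrite natrM invfM -mulrnAr -[_ *+ k.+1]mulr_natl [k.+1%:R * _]mulrA divff ?mul1r//.
Qed.

Lemma tcoef_dird1 (R : realType) (V : normedModType R) (A : set V) (e1 e2 z : V)
    (g : V -> R) i j :
  open A -> class_C j.+1 A g -> A z ->
  tcoef e1 e2 z (dird e1 g) i j = tcoef e1 e2 z g i.+1 j *+ i.+1.
Proof.
move=> oA gC Az; rewrite /tcoef (eq_in_iter_dird _ _ oA (iter_dird_comm _ _ oA gC))//.
by rewrite -iterSr factS -mulnA divr_mulSn.
Qed.

Lemma tcoef_dird2 (R : realType) (V : normedModType R) (e1 e2 z : V) (g : V -> R) i j :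
  tcoef e1 e2 z (dird e2 g) i j = tcoef e1 e2 z g i j.+1 *+ j.+1.
Proof.
by rewrite /tcoef -iterSr factS mulnCA divr_mulSn.
Qed.

(* In [{poly {poly R}}] the inner variable is space and the outer one is time. *)
Definition tpoly (R : realType) (n : nat) (q : nat -> nat -> R) : {poly {poly R}} :=
  \poly_(j < n) \poly_(i < n - j) q i j.

Lemma coef_tpoly (R : realType) n (q : nat -> nat -> R) i j :
  (tpoly n q)`_j`_i = if (i + j < n)%N then q i j else 0.
Proof.
rewrite /tpoly coef_poly; case: ltnP => jn; last first.
  by rewrite coef0 ltnNge (leq_trans jn)// leq_addl.
by rewrite coef_poly ltn_subRL addnC.
Qed.

Lemma tpoly_dX (R : realType) n (q q1 : nat -> nat -> R) :
  (forall i j, (i + j < n)%N -> q1 i j = q i.+1 j *+ i.+1) ->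
  map_poly (@deriv R) (tpoly n.+1 q) = tpoly n q1.
Proof.
move=> qE; apply/polyP => j; apply/polyP => i.
rewrite coef_map /= coef_deriv !coef_tpoly addSn ltnS.
by case: ifPn => [/qE ->//|_]; rewrite mul0rn.
Qed.

Lemma tpoly_dT (R : realType) n (q q2 : nat -> nat -> R) :
  (forall i j, (i + j < n)%N -> q2 i j = q i j.+1 *+ j.+1) ->
  deriv (tpoly n.+1 q) = tpoly n q2.
Proof.
move=> qE; apply/polyP => j; apply/polyP => i.
rewrite coef_deriv coefMn !coef_tpoly addnS ltnS.
by case: ifPn => [/qE ->//|_]; rewrite mul0rn.
Qed.

Lemma is_derive_horner2 (R : realType) (Q : {poly {poly R}}) (a b h : R) :
  is_derive h (1 : R) (fun h => Q.[(b * h)%:P].[a * h] : R^o)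
    (a * (map_poly (@deriv R) Q).[(b * h)%:P].[a * h] + b * Q^`().[(b * h)%:P].[a * h]).
Proof.
have lin (c : R) : is_derive h (1 : R) (fun h => c * h : R^o) c.
  by apply: is_derive_eq; rewrite -[_ *: _]/(_ * _) mulr1.
elim/poly_ind: Q => [|Q c IH].
  rewrite (_ : (fun _ => _) = fun=> 0); last by apply/funext => k; rewrite !horner0.
  by apply: is_derive_eq; rewrite raddf0 deriv0 !horner0 !mulr0 addr0.
rewrite (_ : (fun _ => _) =
    (fun h => Q.[(b * h)%:P].[a * h] : R^o) * (fun h => b * h : R^o) +
    (horner c \o (fun h => a * h))); last first.
  by apply/funext => k; rewrite !(hornerD, hornerM, hornerX, hornerC).
have dc : is_derive h (1 : R) (horner c \o (fun h => a * h)) (c^`().[a * h] * a).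
  exact: is_derive1_comp.
have := @is_deriveD _ _ _ _ _ _ _ _ _ (is_deriveM IH (lin b)) dc.
move=> D; apply: (is_derive_eq D).
rewrite [map_poly _ (_ + _)]raddfD/= map_derivM map_polyC /= derivMXaddC.
have -> : map_poly (@deriv R) 'X = 0 :> {poly {poly R}}.
  by apply/polyP => k; rewrite coef_map coefX coef0 /=; case: eqP => _; rewrite ?derivC.
rewrite !(hornerD, hornerM, hornerX, hornerC, mulr0, addr0, horner0).
by rewrite -![_ *: _]/(_ * _); ring.
Qed.

(** Along the ray, the derivative of the remainder of [g] is [a] times the remainder of [dird e1 g]
    plus [b] times that of [dird e2 g], both one order lower; [isO_primitive] then closes the
    induction on [n]. *)
Lemma taylor_dirs (R : realType) (V : normedModType R) (A : set V) (e1 e2 z : V) n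
    (g : V -> R) (a b : R) :
  open A -> A z -> class_C n A g ->
  isO (nbhs (0 : R)) n (fun h => g (z + h *: (a *: e1 + b *: e2)) -
    (tpoly n (tcoef e1 e2 z g)).[(b * h)%:P].[a * h]).
Proof.
move=> oA Az; set v := a *: e1 + b *: e2.
elim: n g => [|n IH] g gC.
  apply: (@isO_ext _ _ _ _ (fun h => g (z + h *: v))).
    move=> h; rewrite (_ : tpoly 0 _ = 0) ?horner0 ?subr0//.
    by apply/polyP => j; rewrite coef0 /tpoly coef_poly.
  apply: isO_continuous => //; apply: continuous_comp; last first.
    by rewrite scale0r addr0; exact: class_C_cont gC Az.
  by apply: cvgD; [exact: cvg_cst|apply: cvgZr_tmp; exact: cvg_id].
have nA : \forall h \near (0 : R), A (z + h *: v).
  have [d d0 dA] := ray_nbhs v 0 (open_nbhs_nbhs (conj oA Az)).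
  exists d => // h; rewrite /= sub0r normrN => hd.
  by have := dA h 0 hd; rewrite normr0 => /(_ d0); rewrite scale0r addr0.
have C1 : class_C 1 A g by exact: class_CW gC.
(* The remainder vanishes at [h = 0], which gives it the form of an increment. *)
have -> : (fun h => g (z + h *: v) - (tpoly n.+1 (tcoef e1 e2 z g)).[(b * h)%:P].[a * h])
  = (fun h => (fun h => g (z + h *: v) - (tpoly n.+1 (tcoef e1 e2 z g)).[(b * h)%:P].[a * h]) h -
     (fun h => g (z + h *: v) - (tpoly n.+1 (tcoef e1 e2 z g)).[(b * h)%:P].[a * h]) 0).
  apply/funext => h /=; rewrite !mulr0 scale0r addr0 !horner_coef0 coef_tpoly /=.
  by rewrite /tcoef /= divr1 subrr subr0.
apply: (isO_primitive (dg := fun h =>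
   a * (dird e1 g (z + h *: v) - (tpoly n (tcoef e1 e2 z (dird e1 g))).[(b * h)%:P].[a * h]) +
   b * (dird e2 g (z + h *: v) - (tpoly n (tcoef e1 e2 z (dird e2 g))).[(b * h)%:P].[a * h]))).
  near=> h; have Ah : A (z + h *: v) by near: h.
  have D1 := is_derive_ray (class_C_derivable gC Ah : derivable _ _ v).
  have := @is_deriveB _ _ _ _ _ _ _ _ _ D1 (is_derive_horner2 (tpoly n.+1 (tcoef e1 e2 z g)) a b h).
  move=> D; apply: (is_derive_eq D).
  rewrite (tpoly_dX (q1 := tcoef e1 e2 z (dird e1 g))); last first.
    move=> i j ij; apply: tcoef_dird1 oA _ Az; apply: class_CW gC.
    by rewrite ltnS (leq_trans (leq_addl i j))// ltnW.
  rewrite (tpoly_dT (q2 := tcoef e1 e2 z (dird e2 g))); last first.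
    by move=> i j _; exact: tcoef_dird2.
  rewrite (dirdD _ _ oA C1 Ah) !(dirdZ _ _ C1 Ah).
  by rewrite !mulrBr opprD addrACA.
by apply: isOD; apply: isOZ; apply: IH; exact: class_C_dird gC.
Unshelve. all: by end_near. Qed.

(** A single [Q] serves [g] and both of its first derivatives, so that the differential equation can
    be transferred to the coefficients of [Q]. *)
Lemma taylor2 (R : realType) (V : normedModType R) (A : set V) (e1 e2 z : V) n
    (g : V -> R) : open A -> A z -> class_C n.+1 A g ->
  exists Q : {poly {poly R}}, Q.[0].[0] = g z /\ forall a b : R,
    [/\ isO (nbhs (0 : R)) n.+1 (fun h =>
          g (z + h *: (a *: e1 + b *: e2)) - Q.[(b * h)%:P].[a * h]),
        isO (nbhs (0 : R)) n (fun h => dird e1 g (z + h *: (a *: e1 + b *: e2)) -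
          (map_poly (@deriv R) Q).[(b * h)%:P].[a * h]) &
        isO (nbhs (0 : R)) n (fun h => dird e2 g (z + h *: (a *: e1 + b *: e2)) -
          Q^`().[(b * h)%:P].[a * h])].
Proof.
move=> oA Az gC; exists (tpoly n.+1 (tcoef e1 e2 z g)); split.
  by rewrite !horner_coef0 coef_tpoly /tcoef /= divr1.
move=> a b; split; first exact: (@taylor_dirs R V A e1 e2 z n.+1 g a b oA Az gC).
  rewrite (tpoly_dX (q1 := tcoef e1 e2 z (dird e1 g))); last first.
    move=> i j ij; apply: tcoef_dird1 oA _ Az; apply: class_CW gC.
    by rewrite ltnS (leq_trans (leq_addl i j))// ltnW.
  exact: (@taylor_dirs R V A e1 e2 z n _ a b oA Az (@class_C_dird R V n A g e1 gC)).
rewrite (tpoly_dT (q2 := tcoef e1 e2 z (dird e2 g))); last first.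
  by move=> i j _; exact: tcoef_dird2.
exact: (@taylor_dirs R V A e1 e2 z n _ a b oA Az (@class_C_dird R V n A g e2 gC)).
Qed.

Lemma poly_antiderivative (R : realType) (P : {poly R}) (c : R) :
  exists2 S : {poly R}, deriv S = P & S.[0] = c.
Proof.
pose S := \poly_(i < (size P).+1) (if i is i'.+1 then P`_i' / i%:R else c).
exists S; last by rewrite horner_coef0 coef_poly.
apply/polyP => i; rewrite coef_deriv coef_poly ltnS /=.
case: ltnP => [_|Pi]; last by rewrite mul0rn nth_default.
by rewrite -mulrnAl -mulr_natr mulfK// pnatr_eq0.
Qed.

Lemma taylor1_step (R : realType) n (f : R -> R) (u0 : R) (P1 : {poly R}) :
  class_C 1 [set: R^o] f ->
  isO (nbhs (0 : R)) n (fun y => dird (1 : R^o) f (u0 + y) - P1.[y]) ->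
  exists2 P : {poly R}, deriv P = P1 &
    isO (nbhs (0 : R)) n.+1 (fun y => f (u0 + y) - P.[y]).
Proof.
move=> fC P1O; have [P dP P0] := poly_antiderivative P1 (f u0).
exists P => //.
have -> : (fun y => f (u0 + y) - P.[y]) =
    (fun y => (fun y => f (u0 + y) - P.[y]) y - (fun y => f (u0 + y) - P.[y]) 0).
  by apply/funext => y /=; rewrite addr0 P0 subrr subr0.
apply: isO_primitive P1O; near=> y.
have D1 : is_derive y (1 : R) (fun y => f (u0 + y) : R^o) (dird (1 : R^o) f (u0 + y)).
  have E s : (u0 : R^o) + s *: (1 : R^o) = u0 + s by rewrite -[s *: _]/(s * 1) mulr1.
  have := @is_derive_ray R R^o f u0 1 y; rewrite E.
  rewrite (_ : (fun s => f _) = fun y => f (u0 + y)); last first.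
    by apply/funext => s; rewrite E.
  by apply; exact: class_C_derivable fC I.
by rewrite -dP; exact: is_deriveB.
Unshelve. all: by end_near. Qed.

Lemma taylor1 (R : realType) n (f : R -> R) (u0 : R) :
  class_C n [set: R^o] f ->
  exists P : {poly R}, isO (nbhs (0 : R)) n (fun y => f (u0 + y) - P.[y]).
Proof.
elim: n f => [|n IH] f fC.
  exists 0; apply: isO_continuous => //; apply: cvgB; last first.
    exact: continuous_horner.
  apply: continuous_comp; last exact: class_C_cont fC I.
  by apply: cvgD; [exact: cvg_cst|exact: cvg_id].
have [P1 P1O] := IH _ (@class_C_dird R R^o n _ f 1 fC).
have f1 : class_C 1 [set: R^o] f by exact: class_CW fC.
by have [P _ PO] := taylor1_step f1 P1O; exists P.
Qed.

(** [P] is built as an antiderivative of a polynomial approximating [f'], so that one polynomial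
    approximates [f] together with its derivative. *)
Lemma taylor1_deriv (R : realType) n (f : R -> R) (u0 : R) :
  class_C n.+1 [set: R^o] f ->
  exists P : {poly R},
    isO (nbhs (0 : R)) n.+1 (fun y => f (u0 + y) - P.[u0 + y]) /\
    isO (nbhs (0 : R)) n (fun y => dird (1 : R^o) f (u0 + y) - P^`().[u0 + y]).
Proof.
move=> fC; have [P1 P1O] := taylor1 u0 (@class_C_dird R R^o n _ f 1 fC).
have f1 : class_C 1 [set: R^o] f by exact: class_CW fC.
have [P dP PO] := taylor1_step f1 P1O.
(* Recentring makes [P] a polynomial in the state itself instead of its deviation from [u0], ready
   to be composed with [Q]. *)
exists (P \Po ('X - u0%:P)); split.
  apply: isO_ext PO => y.
  by rewrite horner_comp hornerXsubC [u0 + y]addrC addrK.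
apply: isO_ext P1O => y.
rewrite deriv_comp derivXsubC mulr1 dP horner_comp hornerXsubC.
by rewrite [X in P1.[X - _]]addrC addrK.
Qed.

(** * From rays to coefficients, and the conservation law for Taylor polynomials *)

Lemma horner_eq0_poly (R : realType) (W : {poly R}) :
  (forall a, W.[a] = 0) -> W = 0.
Proof.
move=> W0; apply: (@roots_geq_poly_eq0 _ _ [seq i%:R | i <- iota 0 (size W)]).
- by apply/allP => a _; rewrite /root W0.
- rewrite map_inj_uniq ?iota_uniq// => i j /eqP; rewrite eqr_nat => /eqP //.
- by rewrite size_map size_iota.
Qed.

Lemma horner2_ray (R : realType) (Q : {poly {poly R}}) (a b : R) m :
  exists S : {poly R}, (forall h, Q.[(b * h)%:P].[a * h] = S.[h]) /\
    S`_m = \sum_(j < m.+1) b ^+ j * a ^+ (m - j) * Q`_j`_(m - j).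
Proof.
pose N := (size Q + m.+1)%N.
exists (\sum_(j < N) b ^+ j *: ((Q`_j \Po (a *: 'X)) * 'X^j)); split.
  move=> h; rewrite (@horner_coef_wide {poly R} N Q) ?leq_addr// !horner_sum.
  apply: congr_big => // j _.
  rewrite hornerZ !hornerM horner_comp hornerZ hornerX hornerXn -polyC_exp hornerC.
  by rewrite exprMn; ring.
rewrite (big_ord_widen N (fun j => b ^+ j * a ^+ (m - j) * Q`_j`_(m - j))); last first.
  by rewrite /N leq_addl.
rewrite [RHS]big_mkcond coef_sum; apply: eq_bigr => j _.
rewrite coefZ coefMXn coef_comp_scaleX ltnS [in RHS]leqNgt.
by case: ltnP => _ /=; rewrite ?mulr0// mulrA.
Qed.

(** On the ray of direction [(a, 1)] the coefficient of [h^d] is the homogeneous part of degree [d]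
    of [Q], evaluated at [(a, 1)]. For [d < n] it vanishes for every [a]; hence it is 0 as a
    polynomial in [a], whose coefficients are those of [Q] in total degree [d]. *)
Lemma isO_horner2_eq0 (R : realType) n (Q : {poly {poly R}}) :
  (forall a, isO 0^'+ n (fun h => Q.[h%:P].[a * h])) ->
  forall k m, (k + m < n)%N -> Q`_k`_m = 0.
Proof.
move=> QO k m kmn.
pose W := \sum_(j < (k + m).+1) Q`_j`_(k + m - j) *: 'X^(k + m - j) : {poly R}.
have W0 : W = 0.
  apply: horner_eq0_poly => a.
  have [S [SE Sm]] := @horner2_ray R Q a 1 (k + m).
  transitivity S`_(k + m).
    rewrite Sm /W horner_sum; apply: eq_bigr => j _.
    by rewrite hornerZ hornerXn expr1n mul1r mulrC.
  apply: isO_unique kmn; apply: isO_ext (QO a) => h.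
  by rewrite -SE mul1r.
have : W`_m = 0 by rewrite W0 coef0.
have kkm : (k < (k + m).+1)%N by rewrite ltnS leq_addr.
rewrite /W coef_sum (bigD1 (Ordinal kkm))//= coefZ coefXn addKn eqxx mulr1.
rewrite big1 ?addr0// => j jk; rewrite coefZ coefXn.
have jkm := ltn_ord j; case: eqP => [E|_]; last by rewrite mulr0.
by case/eqP: jk; apply: val_inj => /=; lia.
Qed.

(* [Q] is the Taylor polynomial of [U], and [map_poly polyC P \Po Q] is the composite
   [P(Q(x, t))], [P] being the Taylor polynomial of the flux [f]. *)
Lemma conservation_law_jet (R : realType) (V : normedModType R) n (f : R -> R)
    (U : V -> R) (A : set V) (e1 e2 z : V) :
  (0 < n)%N -> class_C n.+1 [set: R^o] f -> open A -> A z -> class_C n.+1 A U ->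
  (forall y, A y -> dird e2 U y + dird (1 : R^o) f (U y) * dird e1 U y = 0) ->
  exists (Q : {poly {poly R}}) (P : {poly R}),
    [/\ Q.[0].[0] = U z,
      (forall a b, isO 0^'+ n.+1 (fun h =>
          U (z + h *: (a *: e1 + b *: e2)) - Q.[(b * h)%:P].[a * h])),
      isO (nbhs (0 : R)) n.+1 (fun y => f (U z + y) - P.[U z + y]) &
      forall k m, (k + m < n)%N ->
        (Q^`() + map_poly (@deriv R) (map_poly polyC P \Po Q))`_k`_m = 0].
Proof.
move=> n0 fC oA Az UC pde.
have [Q [Q0 QO]] := @taylor2 R V A e1 e2 z n U oA Az UC.
have [P [PO dPO]] := @taylor1_deriv R n f (U z) fC.
have F0 := @cvg_at_right0 R.
have toR m g : isO (nbhs (0 : R)) m g -> isO 0^'+ m g.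
  by move=> [M gM]; exists M; exact: F0 gM.
exists Q, P; split => // [a b|]; first by have [QO1 _ _] := QO a b; exact: toR.
apply: isO_horner2_eq0 => a.
have [/toR QO1 /toR QO2 /toR QO3] := QO a 1.
set v := a *: e1 + 1 *: e2 in QO1 QO2 QO3.
pose Qv h := Q.[(1 * h)%:P].[a * h].
pose Qx h := (map_poly (@deriv R) Q).[(1 * h)%:P].[a * h].
have [S [SE _]] := @horner2_ray R Q a 1 0.
have [Sx [SxE _]] := @horner2_ray R (map_poly (@deriv R) Q) a 1 0.
have Qv1 : isO 0^'+ 1 (fun h => Qv h - U z).
  apply: (@isO_ext _ _ _ _ (fun h => (S - S.[0]%:P).[h])).
    move=> h; rewrite hornerD hornerN hornerC /Qv SE -Q0; congr (_ - _).
    by rewrite -SE !mulr0.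
  by apply: isO_poly => // -[|//] _; rewrite coefB coefC horner_coef0 subrr.
have U1 : isO 0^'+ 1 (fun h => U (z + h *: v) - U z).
  apply: (@isO_ext _ _ _ _ (fun h => (U (z + h *: v) - Qv h) + (Qv h - U z))).
    by move=> h; rewrite subrKA.
  by apply: isOD => //; apply: isO_le QO1.
have Ux0 : isO 0^'+ 0 (fun h => dird e1 U (z + h *: v)).
  apply: (@isO_ext _ _ _ _ (fun h => (dird e1 U (z + h *: v) - Qx h) + Sx.[h])).
    by move=> h; rewrite -SxE subrK.
  apply: isOD; first exact: isO_le QO2.
  by apply: isO_poly.
have fU : isO 0^'+ n (fun h => dird (1 : R^o) f (U (z + h *: v)) - P^`().[U (z + h *: v)]).
  exact: (isO_comp (e := fun y => dird (1 : R^o) f y - P^`().[y]) _ F0 dPO U1).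
have PU : isO 0^'+ n (fun h => P^`().[U (z + h *: v)] - P^`().[Qv h]).
  apply: (@isO_le _ _ _ _ n.+1) => //.
  have vO : isO 0^'+ n.+1 (fun h => U (z + h *: v) - Qv h - 0 * h ^+ n).
    by apply: isO_ext QO1 => h; rewrite mul0r subr0.
  apply: isO_ext (isO_comp_poly _ P^`() F0 n0 Qv1 vO) => h.
  by rewrite mulr0 mul0r subr0.
have PQ : isO 0^'+ 0 (fun h => P^`().[Qv h]).
  apply: (@isO_ext _ _ _ _ (fun h => (P^`() \Po S).[h])).
    by move=> h; rewrite horner_comp -SE.
  exact: isO_poly.
have nA : \forall h \near 0^'+, A (z + h *: v).
  have [d d0 dA] := ray_nbhs v 0 (open_nbhs_nbhs (conj oA Az)).
  apply: F0; exists d => // h; rewrite /= sub0r normrN => hd.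
  by have := dA h 0 hd; rewrite normr0 => /(_ d0); rewrite scale0r addr0.
(* The residual of [Q] is compared with that of [U], which is zero on [A]. Every difference is
   [O(h^n)], the order available for first derivatives, and this fixes the total degree below which
   the equation holds for the polynomials. *)
apply: (@isO_near _ _ _ _ _ (fun h => - (
   (dird e2 U (z + h *: v) - Q^`().[(1 * h)%:P].[a * h]) +
   (dird (1 : R^o) f (U (z + h *: v)) - P^`().[U (z + h *: v)]) * dird e1 U (z + h *: v) +
   (P^`().[U (z + h *: v)] - P^`().[Qv h]) * dird e1 U (z + h *: v) +
   P^`().[Qv h] * (dird e1 U (z + h *: v) - Qx h)))).
  near=> h; have /pde E : A (z + h *: v) by near: h.
  rewrite map_deriv_comp -[h in h%:P]mul1r !hornerD !hornerM horner2_comp -/(Qv h) -/(Qx h).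
  move/eqP: E; rewrite addr_eq0 => /eqP ->.
  have alg (d1 q2 d p p1 qx : R) : q2 + p1 * qx =
    - ((- (d * d1) - q2) + (d - p) * d1 + (p - p1) * d1 + p1 * (d1 - qx)) by ring.
  exact: alg.
apply: isON; apply: isOD; last exact: (isOM _ (m := 0)).
apply: isOD; last by rewrite -[n]addn0; exact: isOM.
by apply: isOD => //; rewrite -[n]addn0; exact: isOM.
Unshelve. all: by end_near. Qed.

(** * Expansion of the CAT scheme *)

(** Since [v - u0] is [O(h)], replacing [f] by [P] at [v] costs only [O(h^(n+1))], and the
    polynomial case applies. *)
Lemma isO_comp_expansion (R : realType) (F : set_system R) (FF : Filter F) n (f : R -> R)
    (P : {poly R}) (u0 C : R) (v b : R -> R) :
  F --> (0 : R) -> (0 < n)%N ->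
  isO (nbhs (0 : R)) n.+1 (fun y => f (u0 + y) - P.[u0 + y]) ->
  isO F 1 (fun h => b h - u0) ->
  isO F n.+1 (fun h => v h - b h - C * h ^+ n) ->
  isO F n.+1 (fun h => f (v h) - P.[b h] - P^`().[u0] * C * h ^+ n).
Proof.
move=> F0 n0 fP b1 vb.
have v1 : isO F 1 (fun h => v h - u0).
  apply: (@isO_ext _ _ _ _ (fun h =>
      (v h - b h - C * h ^+ n) + C * h ^+ n + (b h - u0))).
    by move=> h; rewrite subrK subrKA.
  apply: isOD => //; apply: isOD; first exact: isO_le vb.
  by apply: isOZ; apply: isO_le (isOX _ n).
apply: (@isO_ext _ _ _ _ (fun h => (f (v h) - P.[v h]) +
    (P.[v h] - P.[b h] - P^`().[u0] * C * h ^+ n))).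
  by move=> h; rewrite -[_ - _ - _ in LHS]addrA -[P.[v h] - _ - _]addrA subrKA.
apply: isOD; last exact: isO_comp_poly.
exact: (isO_comp (e := fun y => f y - P.[y]) _ F0 fP v1).
Qed.

(* [cat_ut] and [cat_ft] are multiplied by the power of [dt = lambda * h] that
   removes all divisions from the scheme. *)
Lemma cat_ut_expansion (R : realType) p (f : R -> R) (lambda : R)
    (U : R -> int -> R) (i : R -> int) (Q G : {poly {poly R}}) k :
  (k < 2 * p)%N ->
  (forall m, (k + m < 2 * p)%N -> (Q^`() + map_poly (@deriv R) G)`_k`_m = 0) ->
  (forall j : int, exists C, forall sigma : int, isO 0^'+ (2 * p).+1 (fun h =>
    (lambda * h) ^+ k * cat_ft p f (lambda * h) h (U h) (i h + sigma) k j -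
    k`!%:R * (lambda * h) ^+ k * (G`_k).[(sigma + j)%:~R * h] - C * h ^+ (2 * p))) ->
  forall j : int, exists C, forall sigma : int, isO 0^'+ (2 * p).+1 (fun h =>
    (lambda * h) ^+ k.+1 * cat_ut p f (lambda * h) h (U h) (i h + sigma) k.+1 j -
    k.+1`!%:R * (lambda * h) ^+ k.+1 * (Q`_k.+1).[(sigma + j)%:~R * h] -
    C * h ^+ (2 * p)).
Proof.
move=> kp jet /choice[C ftO] j; set n := (2 * p)%N in kp jet ftO *.
have p0 : (0 < p)%N by lia.
have F0 := @cvg_at_right0 R.
have [Cg CgO] := stencil_deriv j G`_k p0; rewrite -/n in CgO.
(* Two errors occur at order [h^n]: the constants of [cat_ft], carried along linearly, and the
   defect of the space formula on [G_k]. The latter comes with the factor [dt^k] and survives only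
   for [k = 0]. *)
exists (- lambda * (\sum_(s <- stencil p) gamma R p 1 j s * C s +
  k`!%:R * ((k == 0)%N%:R * Cg))) => sigma.
have T1 : isO 0^'+ n.+1 (fun h => - lambda * \sum_(s <- stencil p) gamma R p 1 j s *
    ((lambda * h) ^+ k * cat_ft p f (lambda * h) h (U h) (i h + sigma) k s -
     k`!%:R * (lambda * h) ^+ k * (G`_k).[(sigma + s)%:~R * h] - C s * h ^+ n)).
  by apply: isOZ; apply: isO_sum => s _; apply: isOZ; exact: ftO.
have L0 : isO 0^'+ k (fun h => (lambda * h) ^+ k).
  apply: (@isO_ext _ _ _ _ (fun h => lambda ^+ k * h ^+ k)).
    by move=> h; rewrite exprMn.
  by apply: isOZ; exact: isOX.
have FR : Filter (0 : R)^'+ by exact: _.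
have T2 := isOZ FR (- lambda * k`!%:R)
  (isO_le FR F0 (leq_addl k n.+1) (isOM FR L0 (CgO sigma))).
have T3 : isO 0^'+ n.+1 (fun h => (- lambda * k`!%:R * Cg) *
    ((lambda * h) ^+ k * h ^+ n - (k == 0)%N%:R * h ^+ n)).
  apply: isOZ; case: (k) L0 => [|k'] L0.
    apply: (@isO_ext _ _ _ _ (fun=> 0)); last exact: isO0.
    by move=> h; rewrite expr0 !mul1r subrr.
  apply: (@isO_le _ _ _ _ (k'.+1 + n)%N) => //; first by rewrite addSn ltnS leq_addl.
  apply: isO_ext (isOM _ L0 (isOX _ n)) => h.
  by rewrite mul0r subr0.
(* Here the conservation law enters: the [k]-th time coefficient of [Q_T + G_X] has no power of [X]
   below [n - k], and [h^(k+1)] supplies the remaining orders. *)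
have T4 : isO 0^'+ n.+1 (fun h => (- (k`!%:R) * lambda ^+ k.+1) *
    (h ^+ k.+1 * ((Q^`() + map_poly (@deriv R) G)`_k).[(sigma + j)%:~R * h])).
  apply: isOZ; have -> : n.+1 = (k.+1 + (n - k))%N by lia.
  apply: isOM; first exact: isOX.
  by apply: isO_horner => // m mk; apply: jet; lia.
apply: (isO_near _ _ (isOD _ (isOD _ (isOD _ T1 T2) T3) T4)); near=> h.
have h0 : h != 0 by apply: lt0r_neq0; near: h; exact: nbhs_right_gt.
rewrite cat_utS coefD coef_deriv coef_map /= hornerD hornerMn.
have -> : \sum_(s <- stencil p) gamma R p 1 j s *
    ((lambda * h) ^+ k * cat_ft p f (lambda * h) h (U h) (i h + sigma) k s -
     k`!%:R * (lambda * h) ^+ k * (G`_k).[(sigma + s)%:~R * h] - C s * h ^+ n) =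
  (lambda * h) ^+ k * (\sum_(s <- stencil p) gamma R p 1 j s *
     cat_ft p f (lambda * h) h (U h) (i h + sigma) k s) -
  k`!%:R * (lambda * h) ^+ k * (\sum_(s <- stencil p) gamma R p 1 j s *
     (G`_k).[(sigma + s)%:~R * h]) - (\sum_(s <- stencil p) gamma R p 1 j s * C s) * h ^+ n.
  rewrite mulr_suml !mulr_sumr -!sumrB; apply: eq_bigr => s _; ring.
have alg (S1 S2 S3 L c q g' gk hn lk d : R) : L = lk * h ^+ k ->
    lambda * h * L * (- h^-1 * S1) - (k.+1)%:R * gk * (lambda * h * L) * q
     - - lambda * (S3 + gk * (d * c)) * hn =
    - lambda * (L * S1 - gk * L * S2 - S3 * hn) +
    - lambda * gk * (L * (S2 - h * g' - c * hn)) +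
    - lambda * gk * c * (L * hn - d * hn) +
    - gk * (lambda * lk) * (h * h ^+ k * (q *+ k.+1 + g')).
  move=> ->; rewrite -mulr_natl; field; exact: h0.
by rewrite !exprS factS natrM; apply: alg; rewrite exprMn.
Unshelve. all: by end_near. Qed.

(** The predictor at time level [r] is [Q] truncated at [T^k], up to [Ca r * h^n]; [f] multiplies
    this error by [P'(u0)], and the time formula extracts the [k]-th coefficient. *)
Lemma cat_ft_expansion_step (R : realType) p (f : R -> R) (lambda : R)
    (U : R -> int -> R) (i : R -> int) (Q : {poly {poly R}}) (P : {poly R}) k :
  0 < lambda -> (0 < k < 2 * p)%N ->
  isO (nbhs (0 : R)) (2 * p).+1 (fun y => f (Q.[0].[0] + y) - P.[Q.[0].[0] + y]) ->
  (forall m : int, isO 0^'+ (2 * p).+1 (fun h =>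
     U h (i h + m) - Q.[0].[m%:~R * h])) ->
  (forall l, (0 < l <= k)%N -> forall j : int, exists C, forall sigma : int,
    isO 0^'+ (2 * p).+1 (fun h =>
    (lambda * h) ^+ l * cat_ut p f (lambda * h) h (U h) (i h + sigma) l j -
    l`!%:R * (lambda * h) ^+ l * (Q`_l).[(sigma + j)%:~R * h] - C * h ^+ (2 * p))) ->
  forall j : int, exists C, forall sigma : int, isO 0^'+ (2 * p).+1 (fun h =>
    (lambda * h) ^+ k * cat_ft p f (lambda * h) h (U h) (i h + sigma) k j -
    k`!%:R * (lambda * h) ^+ k *
      ((map_poly polyC P \Po Q)`_k).[(sigma + j)%:~R * h] - C * h ^+ (2 * p)).
Proof.
move=> lambda0 /andP[k0 kp] fP UQ ut j; set n := (2 * p)%N in kp fP UQ ut *.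
set u0 := Q.[0].[0] in fP.
have n0 : (0 < n)%N by exact: leq_trans kp.
have F0 := @cvg_at_right0 R.
(* Choice asks for a constant at every [l]; outside the range it is 0. *)
have /choice[Cu utO] : forall l, exists C, (0 < l <= k)%N -> forall sigma : int,
    isO 0^'+ n.+1 (fun h =>
    (lambda * h) ^+ l * cat_ut p f (lambda * h) h (U h) (i h + sigma) l j -
    l`!%:R * (lambda * h) ^+ l * (Q`_l).[(sigma + j)%:~R * h] - C * h ^+ n).
  move=> l; case: (boolP (0 < l <= k)%N) => [lk|_]; last by exists 0.
  by have [C CO] := ut l lk j; exists C.
pose H := map_poly polyC P \Po take_poly k.+1 Q.
have [Ct CtO] := @time_quadrature R p k H lambda kp; rewrite -/n in CtO.
pose Ca (r : int) := \sum_(1 <= l < k.+1) r%:~R ^+ l / l`!%:R * Cu l.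
(* Independence of [sigma] survives the nonlinearity because [P'] is taken at the fixed state [u0],
   and [time_quadrature] gives the same [Ct] for all slopes [sigma + j]. *)
exists (\sum_(r <- stencil p) gamma R p k 0 r * (P^`().[u0] * Ca r) + Ct) => sigma.
set c := (sigma + j)%:~R.
pose b (r : int) h := (take_poly k.+1 Q).[(r%:~R * (lambda * h))%:P].[c * h].
pose v (r : int) h := U h (i h + sigma + j) + \sum_(1 <= l < k.+1)
  (r%:~R * (lambda * h)) ^+ l / l`!%:R *
  cat_ut p f (lambda * h) h (U h) (i h + sigma) l j.
have b1 r : isO 0^'+ 1 (fun h => b r h - u0).
  have [S [SE _]] := @horner2_ray R (take_poly k.+1 Q) c (r%:~R * lambda) 0.
  apply: (@isO_ext _ _ _ _ (fun h => (S - S.[0]%:P).[h])).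
    move=> h; rewrite hornerD hornerN hornerC /b -!SE mulrA; congr (_ - _).
    by rewrite !mulr0 /u0 !horner_coef0 coef_take_poly.
  by apply: isO_poly => // -[|//] _; rewrite coefB coefC horner_coef0 subrr.
have vb r : isO 0^'+ n.+1 (fun h => v r h - b r h - Ca r * h ^+ n).
  apply: (@isO_ext _ _ _ _ (fun h =>
    (U h (i h + (sigma + j)) - Q.[0].[c * h]) +
    \sum_(l <- index_iota 1 k.+1) r%:~R ^+ l / l`!%:R *
    ((lambda * h) ^+ l * cat_ut p f (lambda * h) h (U h) (i h + sigma) l j -
    l`!%:R * (lambda * h) ^+ l * (Q`_l).[c * h] - Cu l * h ^+ n))).
    move=> h; have -> : b r h = Q.[0].[c * h] + \sum_(1 <= l < k.+1)
        (r%:~R * (lambda * h)) ^+ l * (Q`_l).[c * h].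
      rewrite /b (@horner_coef_wide {poly R} k.+1 (take_poly k.+1 Q)) ?size_take_poly// horner_sum.
      rewrite big_ord_recl /= coef_take_poly /= expr0 mulr1 horner_coef0; congr (_ + _).
      rewrite big_add1 big_mkord; apply: eq_bigr => l _.
      by rewrite coef_take_poly ltnS ltn_ord -polyC_exp hornerM hornerC mulrC.
    rewrite /v /Ca -[i h + sigma + j]addrA mulr_suml.
    have E (X u q Y Z : R) : X + u - (q + Y) - Z = X - q + (u - Y - Z) by ring.
    rewrite E.
    congr (_ + _); rewrite -!sumrB; apply: eq_big_nat => l _.
    rewrite !exprMn; field; by rewrite pnatr_eq0 -lt0n fact_gt0.
  apply: isOD; first exact: UQ.
  apply: isO_sum => l; rewrite mem_index_iota ltnS => lk; apply: isOZ; exact: utO.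
have FR : Filter (0 : R)^'+ by exact: _.
have fv r := isO_comp_expansion FR F0 n0 fP (b1 r) (vb r).
have T1 : isO 0^'+ n.+1 (fun h => \sum_(r <- stencil p) gamma R p k 0 r *
    (f (v r h) - P.[b r h] - P^`().[u0] * Ca r * h ^+ n)).
  by apply: isO_sum => r _; apply: isOZ; exact: fv.
apply: (isO_near _ _ (isOD _ T1 (CtO c))); near=> h.
have h0 : 0 < h by near: h; exact: nbhs_right_gt.
have lh0 : (lambda * h) ^+ k != 0 by rewrite expf_neq0// mulf_neq0// lt0r_neq0.
rewrite cat_ftS// mulrA divff// mul1r.
have -> : H`_k = (map_poly polyC P \Po Q)`_k.
  apply: (@coef_comp_eq _ _ _ _ k) => // m mk.
  by rewrite coef_take_poly ltnS mk.
have -> : \sum_(r <- stencil p) gamma R p k 0 r *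
    (f (v r h) - P.[b r h] - P^`().[u0] * Ca r * h ^+ n) =
  \sum_(r <- stencil p) gamma R p k 0 r * f (v r h) -
  \sum_(r <- stencil p) gamma R p k 0 r * P.[b r h] -
  (\sum_(r <- stencil p) gamma R p k 0 r * (P^`().[u0] * Ca r)) * h ^+ n.
  by rewrite mulr_suml -!sumrB; apply: eq_bigr => r _; ring.
have -> : \sum_(r <- stencil p) gamma R p k 0 r *
    H.[(r%:~R * (lambda * h))%:P].[c * h] =
  \sum_(r <- stencil p) gamma R p k 0 r * P.[b r h].
  by apply: eq_bigr => r _; rewrite horner2_comp.
rewrite -/c /v; set X := \sum_(r <- _) _ * P.[_]; set Y := \sum_(r <- _) _.
set Z := \sum_(r <- _) _; set T := _ * _.[_].
by move: X Y Z T => X Y Z T; ring.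
Unshelve. all: by end_near. Qed.

(** The induction has to be strong: the predictor of level [k] uses [cat_ut] at every [l <= k], and
    each of these comes from [cat_ft] at [l - 1]. *)
Lemma cat_ft_expansion (R : realType) p (f : R -> R) (lambda : R)
    (U : R -> int -> R) (i : R -> int) (Q : {poly {poly R}}) (P : {poly R}) :
  0 < lambda ->
  isO (nbhs (0 : R)) (2 * p).+1 (fun y => f (Q.[0].[0] + y) - P.[Q.[0].[0] + y]) ->
  (forall m : int, isO 0^'+ (2 * p).+1 (fun h =>
     U h (i h + m) - Q.[0].[m%:~R * h])) ->
  (forall k m, (k + m < 2 * p)%N ->
     (Q^`() + map_poly (@deriv R) (map_poly polyC P \Po Q))`_k`_m = 0) ->
  forall k, (k < 2 * p)%N ->
  forall j : int, exists C, forall sigma : int, isO 0^'+ (2 * p).+1 (fun h =>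
    (lambda * h) ^+ k * cat_ft p f (lambda * h) h (U h) (i h + sigma) k j -
    k`!%:R * (lambda * h) ^+ k *
      ((map_poly polyC P \Po Q)`_k).[(sigma + j)%:~R * h] - C * h ^+ (2 * p)).
Proof.
move=> lambda0 fP UQ jet; elim/ltn_ind => -[_|k IH] kp; last first.
  apply: cat_ft_expansion_step => // l /andP[l0 lk].
  rewrite -(prednK l0); apply: (@cat_ut_expansion R p f lambda U i Q _ l.-1).
  - by lia.
  - by move=> m; exact: jet.
  - by apply: IH; lia.
(* At [k = 0] the data agree with [Q] up to [O(h^(n+1))], so there is no error at order [h^n]
   yet. *)
move=> j; exists 0 => sigma; have F0 := @cvg_at_right0 R.
have b1 : isO 0^'+ 1 (fun h => Q.[0].[(sigma + j)%:~R * h] - Q.[0].[0]).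
  apply: (@isO_ext _ _ _ _ (fun h => (Q.[0] - Q.[0].[0]%:P).[(sigma + j)%:~R * h])).
    by move=> h; rewrite hornerD hornerN hornerC.
  by apply: isO_horner => // -[|//] _; rewrite coefB coefC [Q.[0].[0]]horner_coef0 subrr.
have vb : isO 0^'+ (2 * p).+1 (fun h => U h (i h + (sigma + j)) -
    Q.[0].[(sigma + j)%:~R * h] - 0 * h ^+ (2 * p)).
  by apply: isO_ext (UQ (sigma + j)) => h; rewrite mul0r subr0.
apply: isO_ext (isO_comp_expansion _ F0 kp fP b1 vb) => h.
rewrite !expr0 !mul1r mulr0 !mul0r cat_ft0 addrA.
rewrite -[in LHS]horner_coef0 -[0 in LHS]/(0%:P).
by rewrite horner2_comp.
Qed.

(** The index [i + 0] is kept so that both fluxes are instances of [i + sigma]. *)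
Lemma cat_flux_difference (R : realType) p (f : R -> R) (dt dx : R) (U : int -> R) (i : int) :
  dt / dx * (cat_flux p f dt dx U i - cat_flux p f dt dx U (i - 1)) =
  \sum_(k < 2 * p) dt / dx / k.+1`!%:R * \sum_(j <- stencil p) gamma_half R p j *
    (dt ^+ k * cat_ft p f dt dx U (i + 0) k j - dt ^+ k * cat_ft p f dt dx U (i - 1) k j).
Proof.
rewrite /cat_flux addr0 -sumrB big_add1 big_mkord mulr_sumr; apply: eq_bigr => k _.
set S1 := \sum_(j <- _) _; set S2 := \sum_(j <- _) _; set S := \sum_(j <- _) _.
have -> : S = dt ^+ k * (S1 - S2); last by rewrite /=; ring.
by rewrite /S -sumrB mulr_sumr; apply: eq_bigr => j _; ring.
Qed.

(* With [sigma = 0] and [sigma = -1] for the two fluxes, the error [C j * h ^+ (2 * p)]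
   cancels because it does not depend on [sigma]. *)
Lemma flux_term_expansion (R : realType) p (lambda : R) k (g q : {poly R})
    (ft : int -> int -> R -> R) :
  (0 < p)%N -> g`_1 = - (q`_0 *+ k.+1) ->
  (forall j : int, exists C, forall sigma : int, isO 0^'+ (2 * p).+1 (fun h =>
    ft sigma j h - k`!%:R * (lambda * h) ^+ k * g.[(sigma + j)%:~R * h] -
    C * h ^+ (2 * p))) ->
  isO 0^'+ (2 * p).+1 (fun h =>
    lambda / k.+1`!%:R * \sum_(j <- stencil p) gamma_half R p j * (ft 0 j h - ft (-1) j h) +
    (lambda * h) ^+ k.+1 * q`_0).
Proof.
move=> p0 gq /choice[C ftO].
have F0 := @cvg_at_right0 R; have FR : Filter (0 : R)^'+ by exact: _.
set n := (2 * p)%N in ftO *.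
have L0 : isO 0^'+ 0 (fun h => (lambda * h) ^+ k).
  apply: (@isO_ext _ _ _ _ (fun h => ('X^k : {poly R}).[lambda * h])).
    by move=> h; rewrite hornerXn.
  exact: isO_horner.
have T1 : isO 0^'+ n.+1 (fun h => lambda / k.+1`!%:R *
    \sum_(j <- stencil p) gamma_half R p j *
    ((ft 0 j h - k`!%:R * (lambda * h) ^+ k * g.[(0 + j)%:~R * h] - C j * h ^+ n) -
     (ft (-1) j h - k`!%:R * (lambda * h) ^+ k * g.[(-1 + j)%:~R * h] - C j * h ^+ n))).
  by apply: isOZ; apply: isO_sum => j _; apply: isOZ; apply: isOB; exact: ftO.
(* The exact parts depend only on the node [sigma + j]; summed by parts they become the [delta1]
   formula, whose value is [h * g_1] up to [O(h^(n+1))]. *)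
have T2 := isOZ FR (lambda / k.+1`!%:R * k`!%:R) (isOM FR L0 (@delta_deriv R p g)).
apply: isO_ext (isOD FR T1 T2) => h.
rewrite -(@gamma_half_parts R p (fun j => g.[j%:~R * h])) // horner_coef0 coef_deriv gq.
set S := \sum_(j <- _) _ * (ft _ _ _ - _); set S1 := \sum_(j <- _) _.
set S2 := \sum_(j <- _) _.
have -> : S1 = S - k`!%:R * (lambda * h) ^+ k * S2.
  rewrite /S /S1 /S2 mulr_sumr -sumrB; apply: eq_bigr => j _.
  by rewrite add0r [-1 + j]addrC; ring.
rewrite mulr1n -[q`_0 *+ _]mulr_natr factS natrM exprS.
have k1 : k.+1%:R != 0 :> R by rewrite pnatr_eq0.
have k2 : k`!%:R != 0 :> R by rewrite pnatr_eq0 -lt0n fact_gt0.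
move: (k.+1%:R) (k`!%:R) S S2 ((_ * h) ^+ k) k1 k2 => k1 k2 S' S2' L k10 k20.
by field; exact/andP.
Qed.

Lemma time_taylor (R : realType) n (Q : {poly {poly R}}) (lambda : R) :
  isO 0^'+ n.+1 (fun h => Q.[(lambda * h)%:P].[0] -
    (Q.[0].[0] + \sum_(k < n) (lambda * h) ^+ k.+1 * Q`_k.+1`_0)).
Proof.
pose T := \poly_(k < size Q) Q`_k`_0.
have TE k : T`_k = Q`_k`_0.
  by rewrite coef_poly; case: ltnP => // Qk; rewrite [Q`_k]nth_default// coef0.
apply: (@isO_ext _ _ _ _ (fun h => (T - take_poly n.+1 T).[lambda * h])).
  move=> h; rewrite hornerD hornerN; congr (_ - _).
    rewrite horner_poly (@horner_coef {poly R} Q) horner_sum; apply: eq_bigr => k _.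
    by rewrite -polyC_exp hornerM hornerC horner_coef0.
  rewrite (@horner_coef_wide _ n.+1 (take_poly n.+1 T)) ?size_take_poly// big_ord_recl.
  rewrite coef_take_poly /= TE expr0 mulr1 !horner_coef0; congr (_ + _).
  apply: eq_bigr => k _.
  by rewrite coef_take_poly /= ltnS ltn_ord TE mulrC.
apply: isO_horner => [|m mn]; first exact: cvg_at_right0.
by rewrite coefB coef_take_poly mn subrr.
Qed.

(** Up to [O(h^(n+1))], the [k]-th term of the flux difference is minus the term of degree [k + 1]
    in the time expansion of [Q] at [X = 0], so the two sums cancel. *)
Lemma cat_truncation (R : realType) p (f : R -> R) (lambda : R)
    (U : R -> int -> R) (i : R -> int) (Q : {poly {poly R}}) (P : {poly R}) :
  (0 < p)%N -> 0 < lambda ->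
  isO (nbhs (0 : R)) (2 * p).+1 (fun y => f (Q.[0].[0] + y) - P.[Q.[0].[0] + y]) ->
  (forall m : int, isO 0^'+ (2 * p).+1 (fun h =>
     U h (i h + m) - Q.[0].[m%:~R * h])) ->
  (forall k m, (k + m < 2 * p)%N ->
     (Q^`() + map_poly (@deriv R) (map_poly polyC P \Po Q))`_k`_m = 0) ->
  isO 0^'+ (2 * p).+1 (fun h => Q.[(lambda * h)%:P].[0] - Q.[0].[0] +
    lambda * h / h * (cat_flux p f (lambda * h) h (U h) (i h) -
      cat_flux p f (lambda * h) h (U h) (i h - 1))).
Proof.
move=> p0 lambda0 fP UQ jet.
have F0 := @cvg_at_right0 R; have FR : Filter (0 : R)^'+ by exact: _.
have ftO := cat_ft_expansion lambda0 fP UQ jet.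
have T1 : isO 0^'+ (2 * p).+1 (fun h => \sum_(k <- index_iota 0 (2 * p))
    (lambda / k.+1`!%:R * (\sum_(j <- stencil p) gamma_half R p j *
      ((lambda * h) ^+ k * cat_ft p f (lambda * h) h (U h) (i h + 0) k j -
       (lambda * h) ^+ k * cat_ft p f (lambda * h) h (U h) (i h - 1) k j)) +
     (lambda * h) ^+ k.+1 * Q`_k.+1`_0)).
  apply: isO_sum => k; rewrite mem_index_iota /= => kp.
  apply: (@flux_term_expansion R p lambda k
    (map_poly polyC P \Po Q)`_k Q`_k.+1 (fun sigma j h => (lambda * h) ^+ k *
    cat_ft p f (lambda * h) h (U h) (i h + sigma) k j) p0 _ (ftO k kp)).
  (* The equation at [T^k X^0] is the relation between [g_1] and [q_0] required by
     [flux_term_expansion]. *)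
  have := jet k 0%N; rewrite addn0 => /(_ kp) /eqP.
  rewrite coefD coef_deriv coefD coefMn coef_map /= coef_deriv mulr1n.
  by rewrite addrC addr_eq0 => /eqP.
apply: (isO_near FR _ (isOD FR (time_taylor (2 * p) Q lambda) T1)); near=> h.
have h0 : h != 0 by apply: lt0r_neq0; near: h; exact: nbhs_right_gt.
rewrite cat_flux_difference mulfK// big_split/= !big_mkord opprD.
by rewrite [X in _ = X + _]addrA [X in _ = _ + X]addrC [RHS]addrA subrK.
Unshelve. all: by end_near. Qed.

(** * Partial derivatives in the plane, and the order of the method *)

Lemma growth_rate_fst (R : realType) (U : R * R -> R) (y s : R) :
  (fun h : R => h^-1 *: ((U (h *: ((1, 0) : R * R) + (y, s)) : R^o) - U (y, s))) =
  (fun h : R => h^-1 *: ((U (h *: (1 : R^o) + y, s) : R^o) - U (y, s))).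
Proof.
apply/funext => h; congr (_ *: (U _ - _)).
by rewrite -[h *: (1, 0)]/(h * 1, h * 0) -[LHS]/(h * 1 + y, h * 0 + s) mulr0 add0r.
Qed.

Lemma dird_fst (R : realType) (U : R * R -> R) (y s : R) :
  dird ((1, 0) : R * R) U (y, s) = derive1 (fun y' => U (y', s)) y.
Proof. by rewrite derive1E /dird /derive growth_rate_fst. Qed.

Lemma derivable_fst (R : realType) (U : R * R -> R) (y s : R) :
  derivable (U : R * R -> R^o) (y, s) (1, 0) ->
  derivable (fun y' => U (y', s) : R^o) y (1 : R).
Proof. by rewrite /derivable growth_rate_fst. Qed.

Lemma dird_snd (R : realType) (U : R * R -> R) (y s : R) :
  dird ((0, 1) : R * R) U (y, s) = derive1 (fun s' => U (y, s')) s.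
Proof.
rewrite derive1E /dird /derive.
have -> : (fun h : R => h^-1 *: ((U (h *: ((0, 1) : R * R) + (y, s)) : R^o) - U (y, s))) =
    (fun h : R => h^-1 *: ((U (y, h *: (1 : R^o) + s) : R^o) - U (y, s))).
  apply/funext => h; congr (_ *: (U _ - _)).
  by rewrite -[h *: (0, 1)]/(h * 0, h * 1) -[LHS]/(h * 0 + y, h * 1 + s) mulr0 add0r.
by [].
Qed.

Theorem theorem2 (R : realType) (p : nat) (hp : (1 <= p)%N) :
  exists K : nat,
  forall (f : R -> R) (u : R -> R -> R) (x t lambda : R) (A : set (R * R)%type)
    (x0 : R -> R) (i : R -> int),
  class_C K [set: R^o] f ->
  open A -> A (x, t) ->
  class_C K A (fun z : R * R => u z.1 z.2) ->
  (forall y s, A (y, s) ->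
    derive1 (fun s' : R => u y s') s + derive1 (fun y' : R => f (u y' s)) y = 0) ->
  0 < lambda ->
  (forall dx : R, 0 < dx -> node (x0 dx) dx (i dx) = x) ->
  (fun dx : R =>
     let dt := lambda * dx in
     let U k := u (node (x0 dx) dx k) t in
     u (node (x0 dx) dx (i dx)) (t + dt) - u (node (x0 dx) dx (i dx)) t
     + dt / dx * (cat_flux p f dt dx U (i dx) - cat_flux p f dt dx U (i dx - 1)))
  =O_ (0^'+) (fun dx : R => dx ^+ (2 * p + 1)).
Proof.
(* With [2 * p + 1] derivatives of [f] and [u], the Taylor remainders have the order claimed for the
   method. *)
exists (2 * p).+1 => f u x t lambda A x0 i fC oA Axt uC pde lambda0 nodeE.
set V := fun z : R * R => u z.1 z.2 in uC.
have n0 : (0 < 2 * p)%N by rewrite muln_gt0.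
have pdeV y : A y -> dird ((0, 1) : R * R) V y +
    dird (1 : R^o) f (V y) * dird ((1, 0) : R * R) V y = 0.
  case: y => y s Ays; have := pde y s Ays; rewrite dird_fst dird_snd /V /= => <-.
  congr (_ + _); rewrite [RHS](@derive1_comp _ (fun y' => u y' s) f y); last 2 first.
  - apply: (@derivable_fst R V); exact: class_C_derivable uC Ays.
  - exact: class_C_derivable fC I.
  by rewrite [in RHS](derive1E f).
have [Q [P [Q0 uQ fP jet]]] :=
  @conservation_law_jet R _ (2 * p) f V A (1, 0) (0, 1) (x, t) n0 fC oA Axt uC pdeV.
have rayE (a b h : R) : (x, t) + h *: (a *: ((1, 0) : R * R) + b *: (0, 1)) =
    (x + a * h, t + b * h).
  rewrite -[a *: (1, 0)]/(a * 1, a * 0) -[b *: (0, 1)]/(b * 0, b * 1).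
  rewrite -[(a * 1, _) + _]/(a * 1 + b * 0, a * 0 + b * 1) !mulr0 !mulr1 addr0 add0r.
  by rewrite -[h *: _]/(h * a, h * b) -[LHS]/(x + h * a, t + h * b) ![h * _]mulrC.
have F0 := @cvg_at_right0 R; have FR : Filter (0 : R)^'+ by exact: _.
pose U h k := u (node (x0 h) h k) t.
(* The nodes are on the rays of direction [(m, 0)]. *)
have UQ (m : int) : isO 0^'+ (2 * p).+1 (fun h => U h (i h + m) - Q.[0].[m%:~R * h]).
  apply: (isO_near FR _ (uQ m%:~R 0)); near=> h.
  have h0 : 0 < h by near: h; exact: nbhs_right_gt.
  rewrite rayE mul0r addr0 /V /U /=; congr (u _ _ - _).
  by rewrite -(nodeE h h0) /node intrD mulrDl addrA.
rewrite -Q0 in fP.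
have trunc := cat_truncation hp lambda0 fP UQ jet.
suff [M MO] : isO 0^'+ (2 * p).+1 (fun dx => u (node (x0 dx) dx (i dx)) (t + lambda * dx) -
    u (node (x0 dx) dx (i dx)) t + lambda * dx / dx *
    (cat_flux p f (lambda * dx) dx (U dx) (i dx) -
     cat_flux p f (lambda * dx) dx (U dx) (i dx - 1))).
  (* [M] may be negative, whereas [eqO_exP] asks for a positive constant. *)
  apply/eqO_exP; exists (`|M| + 1); first by rewrite ltr_wpDl.
  near=> h; rewrite (@le_trans _ _ (M * `|h| ^+ (2 * p).+1))//; first by near: h.
  rewrite addn1 normrX ler_wpM2r// (le_trans (ler_norm _))// lerDl//.
(* [cat_truncation] concerns [Q] at time [t + dt]; the Taylor estimate on the ray of direction
   [(0, lambda)] replaces it by [u]. *)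
apply: (isO_near FR _ (isOD FR trunc (uQ 0 lambda))); near=> h.
have h0 : 0 < h by near: h; exact: nbhs_right_gt.
rewrite rayE !mul0r addr0 nodeE// Q0 /V /=.
by ring.
Unshelve. all: by end_near. Qed.
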